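(* Let $\boldsymbol{R}=(R_1,\ldots,R_m)$ be a system of $m\ge2$ rational functions in $\mathbb{Q}(X_1,\ldots,X_m)$ of degree at most $d\ge2$ and height at most $h$. Let $P_1,\ldots,P_s\in\mathbb{Z}[X_1,\ldots,X_m]$ have degree at most $D$ and height at most $H$, and let $V\subset\mathbb{A}^m_{\mathbb{Q}}$ be the variety they define. Assume the iterations of $\boldsymbol{R}$ generically escape $V$. Then there is a constant $c>0$ depending only on $(d,D,h,H,m,s)$ such that, for every real $\varepsilon>0$ and every $N\in\mathbb{N}$ with $$N\ge\exp(c/\varepsilon),$$ there exists $\mathfrak{B}\in\mathbb{N}$ with $\log\mathfrak{B}\le\exp(c/\varepsilon)$ such that, for every prime $p$ not dividing $\mathfrak{B}$ and every $\boldsymbol{w}\in\overline{\mathbb{F}}_p^{\,m}$ with $T(\boldsymbol{w})\ge N$, $$\frac{\#\mathfrak{V}_{\boldsymbol{w}}(\boldsymbol{R},V;p,N)}{N}\le\varepsilon.$$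
   Context: Degree and height of a rational function $R=F/G$ (coprime $F,G\in\mathbb{Z}[X]$) are $\max\{\deg F,\deg G\}$ and $\max\{\mathrm{h}(F),\mathrm{h}(G)\}$, with $\mathrm{h}$ of an integer polynomial the log of the maximal absolute value of its coefficients. Iterates: $R_i^{(0)}=X_i$, $R_i^{(n)}=R_i(R_1^{(n-1)},\ldots,R_m^{(n-1)})$; write $R_i^{(n)}=F_{i,n}/G_{i,n}$ with coprime integer polynomials. The iterations of $\boldsymbol{R}$ generically escape $V$ if for every $k\ge1$ the $k$-th iterate $\boldsymbol{R}^{(k)}$ is well defined and $\{\boldsymbol{w}\in\mathbb{C}^m:(\boldsymbol{w},\boldsymbol{R}^{(k)}(\boldsymbol{w}))\in V(\mathbb{C})\times V(\mathbb{C})\}$ is finite. For a prime $p$, $\boldsymbol{R}_p^{(n)}$ and $V_p$ denote the reductions modulo $p$ of $\boldsymbol{R}^{(n)}$ (reducing $F_{i,n},G_{i,n}$) and of $V$ (reducing $P_1,\ldots,P_s$). For $\boldsymbol{w}\in\overline{\mathbb{F}}_p^{\,m}$, with $G_{i,j}\not\equiv0\pmod p$ for $j<N$, $\mathfrak{V}_{\boldsymbol{w}}(\boldsymbol{R},V;p,N)$ is the set of $n\in\{0,\ldots,N-1\}$ such that $\boldsymbol{R}_p^{(n)}(\boldsymbol{w})$ is defined and lies in $V_p(\overline{\mathbb{F}}_p)$. The orbit of $\boldsymbol{w}$ under the reduced system is $\boldsymbol{w}_0=\boldsymbol{w}$, $\boldsymbol{w}_n=\boldsymbol{R}_p(\boldsymbol{w}_{n-1})$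 (terminating at a pole), and $T(\boldsymbol{w})\in\mathbb{N}\cup\{\infty\}$ is the number of distinct points $\boldsymbol{w}_n$, $n\ge1$, in it. *)

(* Defs.v *)
From HB Require Import structures.
From mathcomp Require Import all_boot all_order all_algebra.
(* The notations of mpoly clash with those of mathcomp-analysis. *)
From mathcomp Require Import -(notations) mpoly.
From mathcomp Require Import boolp classical_sets functions cardinality finmap.
From mathcomp Require Import reals constructive_ereal.
From mathcomp.analysis Require Import exp.
From mathcomp Require Import complex zify.

Set Implicit Arguments.
Unset Strict Implicit.
Unset Printing Implicit Defensive.

Import Order.TTheory GRing.Theory Num.Theory.
Local Open Scope ring_scope.

Local Notation "x %:F" := (@FracField.tofrac _ x).

Definition zpoly (m : nat) : idomainType := mpoly m int.

(* Q(X_1, ..., X_m), as the fraction field of Z[X_1, ..., X_m]. *)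
Definition ratfun (m : nat) : fieldType := {fraction (zpoly m)}.

(* Coprimality is taken in the ring Z[X_1, ..., X_m], so that a common integer
   factor is excluded as well; the only units are 1 and -1. *)
Definition coprime_zpoly (m : nat) (F G : zpoly m) : Prop :=
  forall D A B : zpoly m, F = D * A -> G = D * B -> D \is a GRing.unit.

Definition lowest_terms (m : nat) (r : ratfun m) (F G : zpoly m) : Prop :=
  [/\ G != 0, coprime_zpoly F G & r = F%:F / G%:F].

Lemma ratfun_fracE (m : nat) (r : ratfun m) :
  exists2 FG : zpoly m * zpoly m, FG.2 != 0 & r = FG.1%:F / FG.2%:F.
Proof.
elim/quotW: r => x; exists (\n_x, \d_x) => /=; first exact: denom_ratioP.
have dx_neq0 : (\d_x)%:F != 0 :> ratfun m by rewrite tofrac_eq0 denom_ratioP.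
apply/(canRL (mulfK dx_neq0)); unlock FracField.tofrac.
rewrite -[LHS]FracField.pi_mul; apply/eqP; rewrite FracField.equivf_def.
rewrite /FracField.mulf /= !numden_Ratio ?oner_eq0 ?mulr1 ?denom_ratioP //.
by rewrite mulrC.
Qed.

Lemma lowest_terms_exists (m : nat) (r : ratfun m) :
  exists FG : zpoly m * zpoly m, lowest_terms r FG.1 FG.2.
Proof.
have [[F G] /= G_neq0 ->] := ratfun_fracE r.
have [n] := ubnP (msize G + `|mleadc G|)%N.
elim: n F G G_neq0 => // n IHn F G G_neq0 leGn.
have [coFG|] := pselect (coprime_zpoly F G); first by exists (F, G).
move/existsNP => [E /existsNP[A /existsNP[B]]].
move=> /not_implyP[defF /not_implyP[defG /negP nuE]].
have [E_neq0 B_neq0] : E != 0 /\ B != 0.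
  by apply/andP; rewrite -negb_or -mulf_eq0 -defG.
suff ltBG : (msize B + `|mleadc B| < msize G + `|mleadc G|)%N.
  have [|FG [nz co e]] := IHn A B B_neq0; first exact: leq_trans ltBG leGn.
  exists FG; split=> //; rewrite -e defF defG !tofracM invfM mulrACA.
  by rewrite divff ?mul1r // tofrac_eq0.
have lcE_gt0 : (0 < `|mleadc E|)%N by rewrite absz_gt0 mleadc_eq0.
have lcB_gt0 : (0 < `|mleadc B|)%N by rewrite absz_gt0 mleadc_eq0.
have szE_gt0 : (0 < msize E)%N by rewrite lt0n msize_poly_eq0.
have szG : msize G = (msize E + msize B).-1 by rewrite defG msizeM.
have lcG : `|mleadc G|%N = (`|mleadc E| * `|mleadc B|)%N.
  by rewrite defG mleadM // mleadcM abszM.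
rewrite szG lcG; have [szE_gt1|szE_le1] := ltnP 1 (msize E).
  by rewrite -addSn; apply: leq_add; [lia | rewrite leq_pmull].
have szE : msize E = 1%N by lia.
rewrite szE add1n /= ltn_add2l ltn_Pmull //.
rewrite ltn_neqAle lcE_gt0 andbT; apply: contra nuE => /eqP lcE1.
have EC : E = mpolyC m (mcoeff mnm0 E) by apply: msize1_polyC; rewrite szE.
have lcEC := @mleadcC m int (mcoeff mnm0 E); rewrite -EC in lcEC.
rewrite EC; apply: rmorph_unit.
by rewrite lcEC in lcE1; case: (mcoeff _ _) lcE1 => [[|[]]|[]].
Qed.

Definition lowest (m : nat) (r : ratfun m) : zpoly m * zpoly m :=
  projT1 (cid (lowest_terms_exists r)).
Definition rnum (m : nat) (r : ratfun m) : zpoly m := (lowest r).1.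
Definition rden (m : nat) (r : ratfun m) : zpoly m := (lowest r).2.

Lemma lowestP (m : nat) (r : ratfun m) : lowest_terms r (rnum r) (rden r).
Proof. exact: projT2 (cid (lowest_terms_exists r)). Qed.

(* Total degree; [msize] is one more than it, and the degree of 0 is 0. *)
Definition zdeg (m : nat) (F : zpoly m) : nat := (msize F).-1.

(* The height of 0 is ln 0 = 0. *)
Definition zheight (R : realType) (m : nat) (F : zpoly m) : R :=
  ln (\max_(a <- msupp F) `|mcoeff a F|%N)%:R.

Definition rdeg (m : nat) (r : ratfun m) : nat :=
  maxn (zdeg (rnum r)) (zdeg (rden r)).

Definition rheight (R : realType) (m : nat) (r : ratfun m) : R :=
  Num.max (zheight R (rnum r)) (zheight R (rden r)).

(* The image of F in K[X_1, ..., X_m]. When K has characteristic p this is the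
   reduction of F modulo p. *)
Definition base_change (K : fieldType) (m : nat) (F : zpoly m) : mpoly m K :=
  map_mpoly (intmul 1) F.

Definition zeval (K : fieldType) (m : nat) (F : zpoly m)
    (x : {ffun 'I_m -> K}) : K :=
  meval x (base_change K F).

Definition ratsys (m : nat) : choiceType := {ffun 'I_m -> ratfun m}.

(* The value of a system of rational functions, written in lowest terms over Z,
   at a K-point, undefined when one of the denominators vanishes there.
   For K = Q(X_1, ..., X_m) this is composition of systems; for K an algebraic
   closure of F_p it is evaluation of the reduction of the system modulo p. *)
Definition sys_eval (K : fieldType) (m : nat) (Rs : ratsys m)
    (x : {ffun 'I_m -> K}) : option {ffun 'I_m -> K} :=
  if [forall i, zeval (rden (Rs i)) x != 0]
  then Some [ffun i => zeval (rnum (Rs i)) x / zeval (rden (Rs i)) x]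
  else None.

Definition orbit_point (K : fieldType) (m : nat) (Rs : ratsys m)
    (w : {ffun 'I_m -> K}) (n : nat) : option {ffun 'I_m -> K} :=
  iter n (obind (sys_eval Rs)) (Some w).

(* The n-th iterate R^(n), if well defined: the n-th point of the orbit of the
   generic point (X_1, ..., X_m). *)
Definition sys_iter (m : nat) (Rs : ratsys m) (n : nat) : option (ratsys m) :=
  orbit_point Rs [ffun i => (mpolyX int (mnm1 i) : zpoly m)%:F : ratfun m] n.

(* Value at x of the n-th iterate itself, i.e. through its own expression in
   lowest terms, as opposed to the n-th point of the orbit of x. *)
Definition iter_eval (K : fieldType) (m : nat) (Rs : ratsys m) (n : nat)
    (x : {ffun 'I_m -> K}) : option {ffun 'I_m -> K} :=
  obind (fun Rn : ratsys m => sys_eval Rn x) (sys_iter Rs n).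

Definition in_variety (K : fieldType) (m s : nat) (P : 'I_s -> zpoly m)
    (x : {ffun 'I_m -> K}) : bool :=
  [forall j, zeval (P j) x == 0].

Definition generically_escapes (R : realType) (m s : nat) (Rs : ratsys m)
    (P : 'I_s -> zpoly m) : Prop :=
  forall k : nat, (0 < k)%N ->
    sys_iter Rs k <> None /\
    finite_set [set w : {ffun 'I_m -> R[i]} |
      in_variety P w /\
      exists2 v, iter_eval Rs k w = Some v & in_variety P v]%classic.

(* A time n is counted only when the n-th iterate is defined at w; this already
   forces its denominators not to vanish identically modulo p. *)
Definition visits (K : fieldType) (m s : nat) (Rs : ratsys m)
    (P : 'I_s -> zpoly m) (w : {ffun 'I_m -> K}) (N : nat) : {set 'I_N} :=
  [set n : 'I_N | if iter_eval Rs n w is Some v then in_variety P v else false].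

(* The starting point w_0 = w counts only if it is met again. *)
Definition orbit_set (K : fieldType) (m : nat) (Rs : ratsys m)
    (w : {ffun 'I_m -> K}) : set {ffun 'I_m -> K} :=
  [set x | exists2 n : nat, (0 < n)%N & orbit_point Rs w n = Some x]%classic.

Definition orbit_length (R : realType) (K : fieldType) (m : nat)
    (Rs : ratsys m) (w : {ffun 'I_m -> K}) : \bar R :=
  if pselect (finite_set (orbit_set Rs w))
  then (#|` fset_set (orbit_set Rs w)|)%:R%:E else +oo%E.

(* Main.v *)
(* Iterating without cancellation writes R^(k) as A_k / B_k with integer
   polynomials whose degrees and heights are at most exponential in k.  If a
   long orbit visits V too often modulo p, then some gap 0 < k < L, with L
   about 2 / eps, occurs between too many pairs of visits, and these give
   distinct solutions of
     P_j (x) = 0,  P_j (A_k (x) / B_k (x)) = 0,  y B_k (x) = 1.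
   Over C this system has finitely many solutions, because Z[X_1, ..., X_m]
   has gcds: the reduced denominator of R^(k) divides B_k, so that R^(k) is
   defined wherever B_k does not vanish.

   It remains to bound the zeros modulo p of integer polynomials with finitely
   many complex zeros.  Variables are eliminated one at a time: after the
   substitution x_i -> x_i + y^(b^i) some equation f has a constant leading
   coefficient l in y, and resultants in y of f with sufficiently many
   combinations of the equations cut out the projection of the zero set.  All
   of this is uniform in the field as long as l does not vanish there, and the
   product of the successive l's is the integer to be avoided.  For a fixed
   number of variables the bounds are polynomial in the degrees and the heights,
   hence exponential in L once k < L. *)
Require Import Defs.
From HB Require Import structures.
From mathcomp Require Import all_boot all_order all_algebra.
From mathcomp Require Import -(notations) mpoly.
From mathcomp Require Import boolp classical_sets functions cardinality finmap.
From mathcomp Require Import reals constructive_ereal.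
From mathcomp.analysis Require Import sequences exp.
From mathcomp Require Import perm complex zify ring lra.

Set Implicit Arguments.
Unset Strict Implicit.
Unset Printing Implicit Defensive.

Import Order.TTheory GRing.Theory Num.Theory.
Local Open Scope ring_scope.

(** * Greatest common divisors of polynomials *)

Definition divides (A : idomainType) (a b : A) : Prop := exists c, b = a * c.

(* Euclid's lemma rather than the absence of common factors. *)
Definition relprime (A : idomainType) (a b : A) : Prop :=
  forall c, divides a (b * c) -> divides a c.

Definition has_gcds (A : idomainType) : Prop :=
  forall a b : A, a != 0 ->
  exists g a' b', [/\ a = g * a', b = g * b' & relprime a' b'].

Section GcdPoly.
Variable A : idomainType.
Implicit Types (a b c : A) (f g : {poly A}).

Lemma divides_polyC a f :
  divides a%:P f <-> forall i, divides a f`_i.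
Proof.
split=> [[g ->] i|]; first by exists g`_i; rewrite coefCM.
elim/poly_ind: f => [|f c IHf] afc; first by exists 0; rewrite mulr0.
have [g ->] : divides a%:P f.
  by apply: IHf => i; have := afc i.+1; rewrite coefD coefMX coefC addr0.
have [d] := afc 0; rewrite coefD coefMX coefC add0r /= => ->.
by exists (g * 'X + d%:P); rewrite mulrDr mulrA polyCM.
Qed.

Definition primitive_poly f : Prop :=
  forall a, divides a%:P f -> a \is a GRing.unit.

Lemma primitive_poly_neq0 f : primitive_poly f -> f != 0.
Proof.
move=> pf; apply/eqP => f0; suff: (0 : A) \is a GRing.unit by rewrite unitr0.
by apply: pf; exists 0; rewrite f0 mulr0.
Qed.

Lemma relprime_polyC a b f :
  relprime a b -> divides a%:P (b%:P * f) -> divides a%:P f.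
Proof.
move=> ab /divides_polyC abf; apply/divides_polyC => i; apply: ab.
by have := abf i; rewrite coefCM.
Qed.

Hypothesis gcdA : has_gcds A.

Lemma content_exists f :
  f != 0 -> exists c f1, f = c%:P * f1 /\ primitive_poly f1.
Proof.
elim/poly_ind: f => [|f a IHf]; first by rewrite eqxx.
have [-> | f_neq0 _] := eqVneq f 0.
  rewrite mul0r add0r polyC_eq0 => a_neq0; exists a, 1; rewrite mulr1; split=> //.
  move=> b /divides_polyC/(_ 0)[c]; rewrite coef1 /= => e.
  by apply/unitrPr; exists c.
have [c1 [f1 [ef pf1]]] := IHf f_neq0.
have c1_neq0 : c1 != 0 by apply: contraNneq f_neq0 => c0; rewrite ef c0 polyC0 mul0r.
have [e [c' [a' [ec ea ca]]]] := gcdA a c1_neq0.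
have c'_neq0 : c' != 0 by apply: contraNneq c1_neq0 => c0; rewrite ec c0 mulr0.
exists e, (c'%:P * f1 * 'X + a'%:P); split.
  by rewrite ef ec ea !polyCM mulrDr !mulrA.
move=> b bf.
have b_neq0 : b != 0.
  apply: contraNneq c'_neq0 => b0; case: bf; rewrite b0 polyC0 => g; rewrite mul0r.
  have f1_neq0 := primitive_poly_neq0 pf1.
  move/(congr1 (fun h : {poly A} => h`_(size f1))).
  rewrite coefD coefMX coefC coefCM coef0 size_poly_eq0 (negPf f1_neq0) addr0.
  by move/eqP; rewrite -lead_coefE mulf_eq0 lead_coef_eq0 (negPf f1_neq0) orbF.
have [y ey] : divides b a'.
  by have /divides_polyC/(_ 0) := bf; rewrite coefD coefMX coefC add0r.
have bcf : divides b%:P (c'%:P * f1).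
  apply/divides_polyC => i; have /divides_polyC/(_ i.+1) := bf.
  by rewrite coefD coefMX coefC addr0.
have [t [b' [c'' [eb ec' bc]]]] := gcdA c' b_neq0.
have t_neq0 : t != 0 by apply: contraNneq b_neq0 => c0; rewrite eb c0 mul0r.
have b'U : b' \is a GRing.unit.
  apply: pf1; apply: (relprime_polyC bc); case: bcf => g.
  rewrite ec' eb !polyCM -!mulrA => /mulfI; rewrite polyC_eq0 => /(_ t_neq0) ->.
  by exists g.
have [x ex] : divides b c'.
  by exists (b'^-1 * c''); rewrite eb ec' mulrA mulrK.
have [z ez] : divides c' x.
  by apply: ca; exists y; rewrite ey ex; ring.
apply/unitrPr; exists z; apply: (mulfI c'_neq0).
by rewrite mulr1 {2}ex ez; ring.
Qed.

Lemma primitive_polyM f g :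
  primitive_poly f -> primitive_poly g -> primitive_poly (f * g).
Proof.
have [n] := ubnP (size f + size g)%N; elim: n f g => // n IHn.
suff aux f g d : (size f + size g < n.+1)%N ->
    primitive_poly f -> primitive_poly g ->
    divides d (lead_coef f) -> divides d%:P (f * g) -> d \is a GRing.unit.
  move=> f g lefg pf pg c cfg.
  have c_neq0 : c != 0.
    have := mulf_neq0 (primitive_poly_neq0 pf) (primitive_poly_neq0 pg).
    by case: cfg => h ->; apply: contraNneq => ->; rewrite polyC0 mul0r.
  have [d [c' [f' [ec ef cf]]]] := gcdA (lead_coef f) c_neq0.
  have d_neq0 : d != 0 by apply: contraNneq c_neq0 => d0; rewrite ec d0 mul0r.
  have dU : d \is a GRing.unit.
    apply: (aux f g) => //; first by exists f'.
    by case: cfg => h ->; exists (c'%:P * h); rewrite ec polyCM mulrA.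
  have [x ex] : divides c' (lead_coef g).
    apply: cf; have /divides_polyC/(_ (size (f * g)).-1) := cfg.
    rewrite -lead_coefE lead_coefM ef ec -mulrA => -[x].
    by rewrite -!mulrA => /(mulfI d_neq0) ->; exists x.
  apply: (aux g f); rewrite ?[(size g + _)%N]addnC ?[g * f]mulrC //.
  by exists (d^-1 * x); rewrite ex ec [d * c']mulrC -mulrA mulVKr.
move=> lefg pf pg [x ex] dfg.
have f_neq0 := primitive_poly_neq0 pf.
have df_lead : divides d%:P ((lead_coef f)%:P * 'X^((size f).-1)).
  by exists (x%:P * 'X^((size f).-1)); rewrite ex polyCM mulrA.
pose f1 := f - (lead_coef f)%:P * 'X^((size f).-1).
have ltf1 : (size f1 < size f)%N.
  have sf : (0 < size f)%N by rewrite lt0n size_poly_eq0.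
  have -> : size f = (size f).-1.+1 by rewrite prednK.
  rewrite ltnS; apply/leq_sizeP => j; rewrite leq_eqVlt => /predU1P[<-|lt].
    by rewrite coefB coefCM coefXn eqxx mulr1 lead_coefE subrr.
  rewrite coefB coefCM coefXn gtn_eqF // mulr0 subr0.
  by apply: nth_default; rewrite -(prednK sf).
have ef : f = f1 + (lead_coef f)%:P * 'X^((size f).-1) by rewrite subrK.
have [f1_eq0|f1_neq0] := eqVneq f1 0.
  have : lead_coef f \is a GRing.unit.
    by apply: pf; rewrite {2}ef f1_eq0 add0r; exists 'X^((size f).-1).
  by rewrite ex unitrM => /andP[].
have [k [f2 [ef1 pf2]]] := content_exists f1_neq0.
have k_neq0 : k != 0 by apply: contraNneq f1_neq0 => k0; rewrite ef1 k0 polyC0 mul0r.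
have d_neq0 : d != 0.
  apply: contraNneq f_neq0 => d0.
  by rewrite -lead_coef_eq0 ex d0 mul0r.
have pf2g : primitive_poly (f2 * g).
  apply: IHn => //; rewrite -ltnS; apply: leq_trans lefg.
  by rewrite !ltnS ltn_add2r (leq_trans _ ltf1) // ef1 size_Cmul.
have [t [d' [k' [ed ek dk]]]] := gcdA k d_neq0.
have t_neq0 : t != 0 by apply: contraNneq d_neq0 => t0; rewrite ed t0 mul0r.
have d'U : d' \is a GRing.unit.
  apply: pf2g; apply: (relprime_polyC dk).
  case: dfg => h; rewrite {1}ef mulrDl => /(canRL (addrK _)).
  case: df_lead => h' ->; rewrite ef1 ed ek !polyCM -!mulrA -mulrBr.
  move/mulfI; rewrite polyC_eq0 => /(_ t_neq0) ->.
  by exists (h - h' * g); rewrite mulrBr.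
have tU : t \is a GRing.unit.
  apply: pf; rewrite ef ef1 ek ex ed !polyCM -!mulrA -mulrDr.
  by eexists.
by rewrite ed unitrM tU.
Qed.

Lemma primitive_polyP f a g :
  primitive_poly f -> divides a%:P (f * g) -> divides a%:P g.
Proof.
move=> pf; have f_neq0 := primitive_poly_neq0 pf.
have [->|g_neq0] := eqVneq g 0; first by exists 0; rewrite mulr0.
move=> afg; have [k [g1 [eg pg1]]] := content_exists g_neq0.
have a_neq0 : a != 0.
  have := mulf_neq0 f_neq0 g_neq0.
  by case: afg => h ->; apply: contraNneq => ->; rewrite polyC0 mul0r.
have [t [a' [k' [ea ek ak]]]] := gcdA k a_neq0.
have t_neq0 : t != 0 by apply: contraNneq a_neq0 => t0; rewrite ea t0 mul0r.
have a'U : a' \is a GRing.unit.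
  apply: (primitive_polyM pf pg1); apply: (relprime_polyC ak).
  case: afg => h; rewrite eg ea ek !polyCM -!mulrA mulrCA => /mulfI.
  rewrite polyC_eq0 => /(_ t_neq0) e; exists h; rewrite -e; ring.
exists (a'^-1%:P * (k'%:P * g1)); rewrite eg ek ea !polyCM.
rewrite -!mulrA; congr (_ * _); rewrite mulrA -polyCM divrr // mul1r.
by [].
Qed.

Lemma primitive_poly_factor f g h :
  primitive_poly f -> f = g * h -> primitive_poly h.
Proof.
by move=> pf ef a [k ek]; apply: pf; exists (g * k); rewrite ef ek mulrCA.
Qed.

Lemma has_gcds_poly : has_gcds {poly A}.
Proof.
move=> f g f_neq0; have [->|g_neq0] := eqVneq g 0.
  exists f, 1, 0; rewrite mulr1 mulr0; split=> // c _; exists c.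
  by rewrite mul1r.
have [cf [f1 [ef pf]]] := content_exists f_neq0.
have [cg [g1 [eg pg]]] := content_exists g_neq0.
have f1_neq0 := primitive_poly_neq0 pf; have g1_neq0 := primitive_poly_neq0 pg.
have d_neq0 : gcdp f1 g1 != 0 by rewrite gcdp_eq0 (negPf f1_neq0).
have [c [h [ed ph]]] := content_exists d_neq0.
have h_neq0 := primitive_poly_neq0 ph.
have quo p : gcdp f1 g1 %| p -> exists p', p = h * p'.
  case/Pdiv.Idomain.dvdpP => -[a q] /= a_neq0; rewrite ed -mul_polyC => e.
  have [|p' ep'] := @primitive_polyP h a (c%:P * q) ph.
    by exists p; rewrite e; ring.
  exists p'; apply: (@mulfI _ a%:P); first by rewrite polyC_eq0.
  have -> : a%:P * (h * p') = h * (a%:P * p') by ring.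
  by rewrite e -ep'; ring.
have [f2 ef2] := quo _ (dvdp_gcdl f1 g1).
have [g2 eg2] := quo _ (dvdp_gcdr f1 g1).
have pf2 := primitive_poly_factor pf ef2.
have pg2 := primitive_poly_factor pg eg2.
have [u [v [z z_neq0 bez]]] : exists u v, exists2 z : A, z != 0 &
    u * f2 + v * g2 = z%:P.
  have [[u v] /= /eqpP[[a b] /= /andP[a0 b0]]] := Bezoutp f1 g1.
  rewrite ed -!mul_polyC {1}ef2 {1}eg2 => e.
  exists (a%:P * u), (a%:P * v), (b * c).
    rewrite mulf_neq0 //; apply: contraNneq d_neq0 => c0.
    by rewrite ed c0 polyC0 mul0r.
  apply: (mulfI h_neq0); rewrite polyCM [RHS]mulrC -!mulrA -e; ring.
have rel2 : relprime f2 g2.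
  move=> x [y ey].
  have bezx : z%:P * x = f2 * (u * x + v * y).
    by rewrite mulrDr [f2 * (v * y)]mulrCA -ey -bez; ring.
  have [|w ew] := @primitive_polyP f2 z (u * x + v * y) pf2; first by exists x.
  exists w; apply: (@mulfI _ z%:P); first by rewrite polyC_eq0.
  by rewrite bezx ew; ring.
have cf_neq0 : cf != 0 by apply: contraNneq f_neq0 => k0; rewrite ef k0 polyC0 mul0r.
have [e [c1 [c2 [ec1 ec2 rel12]]]] := gcdA cg cf_neq0.
exists (e%:P * h), (c1%:P * f2), (c2%:P * g2); split.
- by rewrite ef ec1 ef2 polyCM; ring.
- by rewrite eg ec2 eg2 polyCM; ring.
have c2_neq0 : c2 != 0.
  by apply: contraNneq g_neq0 => c20; rewrite eg ec2 c20 mulr0 polyC0 mul0r.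
move=> x [y ey].
have [x2 ex2] : divides f2 (c2%:P * x).
  apply: rel2; exists (c1%:P * y).
  have -> : g2 * (c2%:P * x) = c2%:P * g2 * x by ring.
  by rewrite ey; ring.
have [|x1 ex1] := @primitive_polyP f2 c2 x2 pf2; first by exists x.
have ex : x = f2 * x1.
  apply: (@mulfI _ c2%:P); first by rewrite polyC_eq0.
  by rewrite ex2 ex1; ring.
have e12 : g2 * (c2%:P * x1) = c1%:P * y.
  apply: (@mulfI _ f2); first exact: primitive_poly_neq0.
  have -> : f2 * (c1%:P * y) = c1%:P * f2 * y by ring.
  by rewrite -ey ex; ring.
have [w ew] : divides c1%:P x1.
  by apply: (relprime_polyC rel12); apply: (primitive_polyP pg2); exists y.
by exists w; rewrite ex ew; ring.
Qed.

End GcdPoly.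

Lemma has_gcds_int : has_gcds int.
Proof.
move=> a b a_neq0.
have g_neq0 : gcdz a b != 0 by rewrite gcdz_eq0 (negPf a_neq0).
exists (gcdz a b), (a %/ gcdz a b)%Z, (b %/ gcdz a b)%Z; split.
- by rewrite mulrC divzK // dvdz_gcdl.
- by rewrite mulrC divzK // dvdz_gcdr.
move=> c [d ed]; have : ((a %/ gcdz a b)%Z %| c)%Z.
  rewrite -(Gauss_dvdzr (n := (b %/ gcdz a b)%Z)).
    by rewrite ed dvdz_mulr.
  apply/eqP/(mulfI g_neq0); rewrite mulr1.
  rewrite -[X in X * _]/(`|gcdz a b|%N%:Z) mulz_gcdr ![gcdz a b * _]mulrC.
  by rewrite !divzK ?dvdz_gcdl ?dvdz_gcdr.
by case/dvdzP => q ->; exists q; rewrite mulrC.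
Qed.

(** * Submultiplicative norms on polynomial rings *)

(* With the weights [2 ^ i] a single number bounds both the coefficients of an
   integer polynomial and, through its logarithm, its degree. *)
Definition poly_norm (A : idomainType) (mu : A -> nat) (p : {poly A}) : nat :=
  (\sum_(i < size p) mu (p`_i)%R * 2 ^ i)%N.

Record is_norm (A : idomainType) (mu : A -> nat) : Prop := IsNorm {
  norm_0 : mu 0 = 0%N;
  norm_1 : mu 1 = 1%N;
  norm_N : forall a, mu (- a) = mu a;
  norm_D : forall a b, (mu (a + b)%R <= mu a + mu b)%N;
  norm_M : forall a b, (mu (a * b)%R <= mu a * mu b)%N;
  norm_gt0 : forall a, a != 0%R -> (0 < mu a)%N }.

Section Norm.
Variables (A : idomainType) (mu : A -> nat) (mu_norm : is_norm mu).

Lemma norm_sum (I : Type) (r : seq I) (Q : pred I) (F : I -> A) :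
  (mu (\sum_(i <- r | Q i) F i)%R <= \sum_(i <- r | Q i) mu (F i))%N.
Proof.
elim/big_rec2: _ => [|i n a _ le]; first by rewrite norm_0.
by apply: leq_trans (norm_D mu_norm _ _) _; rewrite leq_add2l.
Qed.

Lemma norm_prod (I : Type) (r : seq I) (Q : pred I) (F : I -> A) :
  (mu (\prod_(i <- r | Q i) F i)%R <= \prod_(i <- r | Q i) mu (F i))%N.
Proof.
elim/big_rec2: _ => [|i n a _ le]; first by rewrite norm_1.
by apply: leq_trans (norm_M mu_norm _ _) _; rewrite leq_mul2l le orbT.
Qed.

Lemma norm_X a n : (mu (a ^+ n)%R <= mu a ^ n)%N.
Proof.
elim: n => [|n IHn]; first by rewrite expr0 norm_1.
by rewrite exprS expnS (leq_trans (norm_M mu_norm _ _)) // leq_mul2l IHn orbT.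
Qed.

Lemma norm_int (z : int) : (mu (z%:~R)%R <= `|z|)%N.
Proof.
suff nat n : (mu (n%:R)%R <= n)%N.
  by case: z => n; [exact: nat | rewrite NegzE rmorphN /= norm_N // nat].
elim: n => [|n IHn]; first by rewrite norm_0.
by rewrite -addn1 natrD (leq_trans (norm_D mu_norm _ _)) // norm_1 ?leq_add2r.
Qed.

Lemma norm_det n (M : 'M[A]_n) (W : nat) :
  (forall i j, mu (M i j) <= W)%N -> (mu (\det M)%R <= n`! * W ^ n)%N.
Proof.
move=> leM; apply: leq_trans (norm_sum _ _ _) _.
have -> : (n`! * W ^ n = \sum_(s : 'S_n) W ^ n)%N.
  by rewrite sum_nat_const card_Sn.
apply: leq_sum => s _; apply: leq_trans (norm_M mu_norm _ _) _.
have sgn : mu ((-1) ^+ s) = 1%N.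
  by case: (odd_perm s); rewrite ?expr1 ?expr0 ?norm_N // norm_1.
rewrite sgn mul1n (leq_trans (norm_prod _ _ _)) //.
have -> : (W ^ n = \prod_(i < n) W)%N by rewrite prod_nat_const card_ord.
exact: leq_prod.
Qed.

Local Notation pnorm := (poly_norm mu).
Implicit Types (p q : {poly A}) (c : A).

Lemma poly_normE k p :
  (size p <= k)%N -> pnorm p = (\sum_(i < k) mu (p`_i)%R * 2 ^ i)%N.
Proof.
move=> lek; rewrite /poly_norm (big_ord_widen _ (fun i => mu (p`_i)%R * 2 ^ i)%N lek).
rewrite big_mkcond; apply: eq_bigr => i _; case: ltnP => // le.
by rewrite nth_default // norm_0.
Qed.

Lemma poly_normMXaddC p c : pnorm (p * 'X + c%:P) = (2 * pnorm p + mu c)%N.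
Proof.
rewrite (@poly_normE (size p).+1); last first.
  by rewrite size_MXaddC; case: ifP.
rewrite big_ord_recl coefD coefMX coefC add0r /= muln1 addnC; congr (_ + _)%N.
rewrite /poly_norm big_distrr /=; apply: eq_bigr => i _.
by rewrite coefD coefMX coefC addr0 /= expnS mulnCA.
Qed.

Lemma poly_normC c : pnorm c%:P = mu c.
Proof.
have := poly_normMXaddC 0 c.
by rewrite mul0r add0r {2}/poly_norm size_poly0 big_ord0.
Qed.

Lemma poly_normX : pnorm 'X = 2%N.
Proof.
have := poly_normMXaddC 1 0.
by rewrite addr0 mul1r poly_normC norm_1 // norm_0.
Qed.

Lemma leq_norm_coef p i : (mu (p`_i)%R <= pnorm p)%N.
Proof.
have [le|lt] := leqP (size p) i; first by rewrite nth_default // norm_0.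
rewrite /poly_norm (bigD1 (Ordinal lt)) //= (leq_trans _ (leq_addr _ _)) //.
by rewrite leq_pmulr // expn_gt0.
Qed.

Lemma poly_norm_is_norm : is_norm pnorm.
Proof.
have nC c p : (pnorm (c%:P * p)%R <= mu c * pnorm p)%N.
  rewrite (@poly_normE (size p)) ?mul_polyC ?size_scale_leq // -mul_polyC.
  rewrite /poly_norm big_distrr leq_sum //= => i _.
  by rewrite coefCM mulnA leq_mul2r norm_M ?orbT.
have pnormD p q : (pnorm (p + q)%R <= pnorm p + pnorm q)%N.
  rewrite (poly_normE (leq_maxl (size p) (size q))).
  rewrite (poly_normE (leq_maxr (size p) (size q))) (poly_normE (size_polyD p q)).
  rewrite -big_split leq_sum //= => i _.
  by rewrite coefD -mulnDl leq_mul2r norm_D ?orbT.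
split=> //.
- by rewrite -polyC0 poly_normC norm_0.
- by rewrite -polyC1 poly_normC norm_1.
- move=> p; rewrite /poly_norm size_polyN; apply: eq_bigr => i _.
  by rewrite coefN norm_N.
- elim/poly_ind => [|p c IHp] q.
    by rewrite mul0r -polyC0 poly_normC norm_0.
  rewrite mulrDl -mulrA ['X * q]mulrC mulrA poly_normMXaddC mulnDl.
  apply: leq_trans (pnormD _ _) _; rewrite leq_add ?nC //.
  rewrite -[p * q * 'X]addr0 poly_normMXaddC norm_0 // addn0 -mulnA.
  by rewrite leq_mul2l IHp orbT.
- move=> p p0; rewrite (leq_trans _ (leq_norm_coef p (size p).-1)) //.
  by rewrite norm_gt0 // -lead_coefE lead_coef_eq0.
Qed.

Lemma size_poly_norm p : p != 0 -> (2 ^ (size p).-1 <= pnorm p)%N.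
Proof.
move=> p_neq0; 
rewrite (poly_normE (leqSpred (size p))) big_ord_recr /= (leq_trans _ (leq_addl _ _)) //.
by rewrite leq_pmull // norm_gt0 // -lead_coefE lead_coef_eq0.
Qed.

Lemma norm_resultant p q W :
  (pnorm p <= W)%N -> (pnorm q <= W)%N ->
  (mu (resultant p q)%R <= ((size q).-1 + (size p).-1)`! *
     W ^ ((size q).-1 + (size p).-1))%N.
Proof.
move=> lepW leqW; apply: norm_det => i j; rewrite Sylvester_mxE.
have coef r k : (pnorm r <= W -> mu (r`_(j - k) *+ (k <= j))%R <= W)%N.
  move=> ler; apply: leq_trans (leq_trans (leq_norm_coef r (j - k)) ler).
  by case: (k <= j)%N; rewrite ?mulr0n ?norm_0.
by case: (fintype.split i) => k; apply: coef.
Qed.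

End Norm.

(** * Iterated polynomial rings and the Kronecker substitution *)

Fixpoint tower (n : nat) : idomainType :=
  if n is k.+1 then {poly tower k} else int.

Fixpoint tnorm (n : nat) : tower n -> nat :=
  match n return tower n -> nat with
  | 0 => absz
  | k.+1 => poly_norm (@tnorm k)
  end.

Lemma tnorm_is_norm n : is_norm (@tnorm n).
Proof.
elim: n => [|n IHn] /=; last exact: poly_norm_is_norm.
split=> //= [a|a b|a b|a]; first exact: abszN.
- by lia.
- by rewrite abszM.
- by rewrite absz_gt0.
Qed.

Fixpoint tvar (n i : nat) : tower n :=
  match n return tower n with
  | 0 => 0
  | k.+1 => if i is j.+1 then (tvar k j)%:P else 'X
  end.

Lemma tnorm_var n i : (i < n)%N -> tnorm (tvar n i) = 2%N.
Proof.
elim: n i => // n IHn [|i] lt /=.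
  by rewrite poly_normX //; apply: tnorm_is_norm.
by rewrite poly_normC ?IHn //; apply: tnorm_is_norm.
Qed.

Section TowerEval.
Variable K : comNzRingType.

Fixpoint teval (n : nat) (u : seq K) : {rmorphism tower n -> K} :=
  match n return {rmorphism tower n -> K} with
  | 0 => intmul 1 : {rmorphism int -> K}
  | k.+1 => (horner_eval (head 0 u) \o map_poly (teval k (behead u))
      : {rmorphism {poly tower k} -> K})
  end.

Lemma tevalS n u (f : tower n.+1) :
  teval n.+1 u f = (map_poly (teval n (behead u)) f).[head 0 u].
Proof. by []. Qed.

Lemma teval_var n u i : (i < n)%N -> teval n u (tvar n i) = nth 0 u i.
Proof.
elim: n u i => // n IHn u [|i] lt; rewrite tevalS /=.
  by rewrite map_polyX hornerX nth0.
by rewrite map_polyC hornerC /= IHn // nth_behead.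
Qed.

Lemma teval_unique n (f : {rmorphism tower n -> K}) (u : seq K) :
  (forall i, (i < n)%N -> f (tvar n i) = nth 0 u i) -> f =1 teval n u.
Proof.
elim: n f u => [|n IHn] f u fu p.
  by rewrite /= -[p in LHS]intz rmorph_int.
rewrite tevalS; elim/poly_ind: p => [|p c IHp]; first by rewrite !rmorph0 horner0.
rewrite !rmorphD !rmorphM /= map_polyX map_polyC hornerMXaddC /= IHp; congr (_ * _ + _).
  by rewrite (fu 0) // nth0.
have -> : f c%:P = (f \o polyC) c by [].
apply: (IHn (f \o polyC : {rmorphism tower n -> K})) => i lt.
by rewrite /= (fu i.+1) // nth_behead.
Qed.

End TowerEval.
Arguments teval : simpl never.

Section Kronecker.
Variable b : nat.

(* Substitutes [y] for the innermost variable of the tower, and [x + y ^ b ^ k]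
   for the one at height [k] above it; [y] becomes the outermost variable. *)
Fixpoint kron (n : nat) : {rmorphism tower n.+1 -> {poly tower n}} :=
  match n return {rmorphism tower n.+1 -> {poly tower n}} with
  | 0 => (idfun : {rmorphism {poly int} -> {poly int}})
  | k.+1 => (horner_eval ('X%:P + 'X^(b ^ k.+1)) \o
      map_poly (map_poly polyC \o kron k)
      : {rmorphism {poly tower k.+1} -> {poly {poly tower k}}})
  end.

Lemma kronS n (f : tower n.+2) :
  kron n.+1 f = (map_poly (map_poly polyC \o kron n) f).['X%:P + 'X^(b ^ n.+1)].
Proof. by []. Qed.

Fixpoint kron_point (K : comNzRingType) (n : nat) (u : seq K) (y : K) : seq K :=
  if n is k.+1 then (head 0 u + y ^+ (b ^ k.+1)) :: kron_point k (behead u) y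
  else [:: y].

Fixpoint kron_inv (K : comNzRingType) (n : nat) (v : seq K) : seq K * K :=
  if n is k.+1 then
    let r := kron_inv k (behead v) in
    (head 0 v - r.2 ^+ (b ^ k.+1) :: r.1, r.2)
  else ([::], head 0 v).

Lemma size_kron_point (K : comNzRingType) n (u : seq K) y : size (kron_point n u y) = n.+1.
Proof. by elim: n u => //= n IHn u; rewrite IHn. Qed.

Lemma size_kron_inv (K : comNzRingType) n (v : seq K) : size (kron_inv n v).1 = n.
Proof. by elim: n v => //= n IHn v; rewrite IHn. Qed.

Lemma kron_invK (K : comNzRingType) n (v : seq K) :
  size v = n.+1 -> kron_point n (kron_inv n v).1 (kron_inv n v).2 = v.
Proof.
elim: n v => [|n IHn] [|x v] //=; first by case: v.
by case=> sv; rewrite subrK IHn.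
Qed.

Lemma kron_pointK (K : comNzRingType) n (u : seq K) y :
  size u = n -> kron_inv n (kron_point n u y) = (u, y).
Proof.
elim: n u => [|n IHn] [|x u] //= [su]; rewrite IHn //=.
by rewrite addrK.
Qed.

Lemma kron_teval (K : comNzRingType) n (u : seq K) y (f : tower n.+1) :
  teval n.+1 (kron_point n u y) f = (map_poly (teval n u) (kron n f)).[y].
Proof.
elim: n u f => [|n IHn] u f; first by [].
rewrite tevalS kronS /=.
pose Phi := (horner_eval y \o map_poly (teval n.+1 u) : {rmorphism {poly tower n.+1} -> K}).
rewrite -[RHS]/(Phi _) -horner_map -map_poly_comp.
have -> : Phi ('X%:P + 'X^(b ^ n.+1)) = head 0 u + y ^+ (b ^ n.+1).
  rewrite /Phi /= rmorphD /= map_polyC map_polyXn /horner_eval hornerD hornerC hornerXn.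
  by rewrite /= map_polyX /horner_eval hornerX.
congr (_.[_]); apply: eq_map_poly => c; apply: etrans (IHn (behead u) c) _.
rewrite -[RHS]/((map_poly (teval n.+1 u) (map_poly polyC (kron n c))).[y]).
rewrite -map_poly_comp; congr (_.[_]); apply: eq_map_poly => a.
by rewrite -[RHS]/(teval n.+1 u a%:P) tevalS map_polyC hornerC.
Qed.

End Kronecker.
Arguments kron : simpl never.

Arguments tnorm : simpl never.

Lemma tnormMXaddC n (f : {poly tower n}) (c : tower n) :
  @tnorm n.+1 (f * 'X + c%:P) = (2 * @tnorm n.+1 f + tnorm c)%N.
Proof. exact: poly_normMXaddC (tnorm_is_norm n) _ _. Qed.

Lemma tnormC n (c : tower n) : @tnorm n.+1 c%:P = tnorm c.
Proof. exact: poly_normC (tnorm_is_norm n) _. Qed.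

Lemma tnormX n : @tnorm n.+1 'X = 2%N.
Proof. exact: poly_normX (tnorm_is_norm n). Qed.

Lemma tnorm_int n (z : int) : @tnorm n z%:~R = `|z|%N.
Proof.
elim: n => [|n IHn]; first by rewrite /= intz.
by rewrite -[z%:~R](rmorph_int (@polyC (tower n))) tnormC.
Qed.

Lemma tower_int_eq0 n (z : int) : ((z%:~R : tower n) == 0) = (z == 0).
Proof.
apply/eqP/eqP => [e|->//]; apply/eqP; rewrite -absz_eq0 -(tnorm_int n) e.
by rewrite (norm_0 (tnorm_is_norm n)).
Qed.

Lemma kron_MXaddC b n (f : {poly tower n.+1}) (c : tower n.+1) :
  kron b n.+1 (f * 'X + c%:P) =
  kron b n.+1 f * ('X%:P + 'X^(b ^ n.+1)) + map_poly polyC (kron b n c).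
Proof. by rewrite kronS rmorphD rmorphM /= map_polyX map_polyC hornerMXaddC. Qed.

Lemma leq_addX x y k : (0 < k)%N -> (x ^ k + y ^ k <= (x + y) ^ k)%N.
Proof.
case: k => // k _; elim: k => // k IHk.
rewrite !(expnS _ k.+1) mulnDl leq_add // leq_mul2l leq_exp2r //.
  by rewrite leq_addr orbT.
by rewrite leq_addl orbT.
Qed.

Lemma tnorm_map_polyC n (f : {poly tower n}) :
  @tnorm n.+2 (map_poly polyC f) = @tnorm n.+1 f.
Proof.
have nn := tnorm_is_norm n; have nn1 := tnorm_is_norm n.+1.
rewrite /tnorm (@poly_normE _ _ nn1 (size f)) ?size_poly //.
by apply: eq_bigr => i _; rewrite coef_map /= tnormC.
Qed.

Lemma tnorm_kron b n (f : tower n.+1) : (0 < b)%N ->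
  (@tnorm n.+1 (kron b n f) <= tnorm f ^ (b ^ n).+1)%N.
Proof.
move=> b_gt0; elim: n f => [|n IHn] f.
  rewrite expn0 (_ : kron b 0 f = f) //; case: (tnorm f) => // k.
  by rewrite expnS leq_pmulr // expn1.
set E := (b ^ n.+1)%N; have E_gt0 : (0 < E)%N by rewrite expn_gt0 b_gt0.
have nn := tnorm_is_norm n.+1; have nn1 := tnorm_is_norm n.+2.
elim/(@poly_ind (tower n.+1)): f => [|f c IHf].
  by rewrite rmorph0 (norm_0 nn1).
rewrite kron_MXaddC tnormMXaddC.
apply: leq_trans (norm_D nn1 _ _) _.
apply: leq_trans (leq_addX _ _ _); last by [].
apply: leq_add; last first.
  rewrite tnorm_map_polyC; apply: leq_trans (IHn c) _.
  case: (tnorm c) => [|k]; first by rewrite !exp0n.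
  by apply: leq_pexp2l; rewrite // ltnS /E expnS leq_pmull.
apply: leq_trans (norm_M nn1 _ _) _.
rewrite expnMn mulnC leq_mul ?IHf //.
apply: leq_trans (norm_D nn1 _ _) _.
rewrite [(2 ^ E.+1)%N]expnS mul2n -addnn leq_add //.
  rewrite tnormC tnormX.
  exact: (@leq_pexp2l 2 1 E).
apply: leq_trans (norm_X nn1 _ _) _.
by rewrite tnormX.
Qed.

Lemma kron_lead b n (f : tower n.+1) : f != 0 -> (tnorm f < 2 ^ b)%N ->
  exists l : int, [/\ l != 0, lead_coef (kron b n f) = l%:~R
    & (size (kron b n f) <= b ^ n.+1)%N].
Proof.
elim: n f => [|n IHn] f f_neq0 ltf.
  have le : (size f <= b)%N.
    have := leq_ltn_trans (size_poly_norm (tnorm_is_norm 0) f_neq0) ltf.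
    by rewrite ltn_exp2l //; case: (size f).
  exists (lead_coef (f : {poly int})); rewrite (_ : kron b 0 f = f) //.
  by rewrite lead_coef_eq0 f_neq0 intz expn1.
have b_gt0 : (0 < b)%N.
  case: b ltf {IHn} => //; rewrite expn0 ltnS leqn0.
  by have := norm_gt0 (tnorm_is_norm n.+2) f_neq0; rewrite lt0n => /negPf ->.
set E := (b ^ n.+1)%N; have E_gt0 : (0 < E)%N by rewrite expn_gt0 b_gt0.
have nn := tnorm_is_norm n.+1; have nn1 := tnorm_is_norm n.+2.
have szf : (size f <= b)%N.
  have := leq_ltn_trans (size_poly_norm nn f_neq0) ltf.
  by rewrite ltn_exp2l //; case: (size f).
suff [l [l0 ll sl]] : exists l : int,
    [/\ l != 0, lead_coef (kron b n.+1 f) = l%:~R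
      & (size (kron b n.+1 f) <= size f * E)%N].
  by exists l; split=> //; rewrite (leq_trans sl) // expnS leq_mul2r szf orbT.
have a_monic : 'X%:P + 'X^E \is @monic (tower n.+1).
  rewrite monicE lead_coefDr ?lead_coefXn //.
  by rewrite size_polyXn (leq_ltn_trans (size_polyC_leq1 _)).
have a_size : size ('X%:P + 'X^E : {poly tower n.+1}) = E.+1.
  rewrite addrC size_polyDl size_polyXn //.
  by rewrite (leq_ltn_trans (size_polyC_leq1 _)).
clear szf; elim/(@poly_ind (tower n.+1)): f f_neq0 ltf => [|f c IHf]; first by rewrite eqxx.
move=> fc_neq0; rewrite tnormMXaddC => ltfc.
have ltc : (tnorm c < 2 ^ b)%N by apply: leq_ltn_trans ltfc; rewrite leq_addl.
rewrite kron_MXaddC size_MXaddC.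
have sc : c != 0 -> exists l : int, [/\ l != 0,
    lead_coef (map_poly polyC (kron b n c)) = l%:~R :> tower n.+1
    & (size (map_poly polyC (kron b n c)) <= E)%N].
  move=> c0; have [l [l0 ll sl]] := IHn c c0 ltc.
  exists l; rewrite lead_coef_map_inj ?ll //; last exact: polyC_inj.
  by rewrite rmorph_int size_map_inj_poly //; exact: polyC_inj.
have [f0|f_neq0] := eqVneq f 0.
  have c0 : c != 0 by apply: contraNneq fc_neq0 => ->; rewrite f0 mul0r add0r.
  have [l [l0 ll sl]] := sc c0.
  exists l; rewrite f0 rmorph0 mul0r add0r (negPf c0) andbF.
  by rewrite size_poly0 mul1n.
have [|l [l0 ll sl]] := IHf f_neq0.
  by apply: leq_ltn_trans ltfc; rewrite mul2n -addnn -addnA leq_addr.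
have kf_neq0 : kron b n.+1 f != 0.
  by rewrite -lead_coef_eq0 ll tower_int_eq0.
have s1 : size (kron b n.+1 f * ('X%:P + 'X^E)) = (size (kron b n.+1 f) + E)%N.
  by rewrite size_Mmonic // a_size addnS.
have ltsz : (size (map_poly polyC (kron b n c)) <
    size (kron b n.+1 f * ('X%:P + 'X^E))%R)%N.
  rewrite s1; have [->|c0] := eqVneq c 0.
    by rewrite !rmorph0 size_poly0 addn_gt0 E_gt0 orbT.
  have [? [_ _ le]] := sc c0; rewrite (leq_ltn_trans le) // -{1}[E]add0n ltn_add2r.
  by rewrite lt0n size_poly_eq0.
exists l; split=> //.
  by rewrite lead_coefDl // lead_coef_Mmonic.
by rewrite size_polyDl // s1 /= mulSn addnC leq_add2l.
Qed.

(** * Elimination of one variable *)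

Lemma resultantE (A : nzRingType) (p q : {poly A}) (k1 k2 : nat) :
    (size q).-1 = k1 -> (size p).-1 = k2 ->
  resultant p q = \det (\matrix_(i < k1 + k2, j < k1 + k2)
    match fintype.split i with
    | inl k => p`_(j - k) *+ (k <= j)
    | inr k => q`_(j - k) *+ (k <= j)
    end).
Proof.
move=> <- <-; congr (\det _); apply/matrixP => i j.
by rewrite Sylvester_mxE mxE.
Qed.

Section CommonRoot.
Variables (A : idomainType) (K : fieldType) (ev : {rmorphism A -> K}).
Variables (F G : {poly A}).
Hypotheses (evF : ev (lead_coef F) != 0) (evG : ev (lead_coef G) != 0).

Lemma rmorph_resultant :
  ev (resultant F G) = resultant (map_poly ev F) (map_poly ev G).
Proof.
rewrite (@resultantE _ F G _ _ erefl erefl).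
rewrite (@resultantE _ _ _ (size G).-1 (size F).-1) ?size_map_poly_id0 //.
rewrite -det_map_mx; congr (\det _); apply/matrixP => i j; rewrite !mxE.
by case: (fintype.split i) => k; rewrite rmorphMn coef_map.
Qed.

Lemma resultant_common_root y :
  root (map_poly ev F) y -> root (map_poly ev G) y -> ev (resultant F G) = 0.
Proof.
move=> yF yG; apply/eqP; rewrite rmorph_resultant resultant_eq0.
apply: (@root_size_gt1 _ y); last by rewrite root_gcd yF.
rewrite gcdp_eq0 negb_and -size_poly_eq0 size_map_poly_id0 // size_poly_eq0.
by apply/orP; left; apply: contraNneq evF => ->; rewrite lead_coef0 rmorph0.
Qed.

End CommonRoot.

Lemma common_root_exists (A : idomainType) (K : closedFieldType)
    (ev : {rmorphism A -> K}) (F G : {poly A}) :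
    ev (lead_coef F) != 0 -> ev (lead_coef G) != 0 -> ev (resultant F G) = 0 ->
  exists y, root (map_poly ev F) y && root (map_poly ev G) y.
Proof.
move=> evF evG /eqP; rewrite rmorph_resultant // resultant_eq0 => lt1.
have /closed_rootP[y] : size (gcdp (map_poly ev F) (map_poly ev G)) != 1%N.
  by rewrite gtn_eqF.
by rewrite root_gcd => yFG; exists y.
Qed.

Definition zeros (n : nat) (K : fieldType) (fs : seq (tower n)) : pred (seq K) :=
  fun v => (size v == n) && all (fun f => teval n v f == 0) fs.

Definition at_most (T : eqType) (V : pred T) (M : nat) : Prop :=
  forall s : seq T, uniq s -> all V s -> (size s <= M)%N.

Lemma leq_fibers (S T : eqType) (f : S -> T) (M : nat) (s : seq S) :
    (forall y, (count (fun x => f x == y) s <= M)%N) ->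
  (size s <= M * size (undup (map f s)))%N.
Proof.
move=> le; suff -> : size s = (\sum_(y <- undup (map f s)) count (fun x => f x == y) s)%N.
  rewrite -sum1_size big_distrr /= leq_sum // => y _.
  by rewrite muln1.
under eq_bigr => y _ do rewrite -sum1_count big_mkcond.
rewrite exchange_big /= -sum1_size [LHS]big_seq [RHS]big_seq; apply: eq_bigr => x xs.
rewrite (bigD1_seq (f x)) /= ?undup_uniq ?mem_undup ?map_f //.
by rewrite eqxx big1 // => y /negPf; rewrite eq_sym => ->.
Qed.

Lemma pigeonhole_seq (S T : eqType) (r : S -> T -> bool) (s : seq S) (t : seq T) (M : nat) :
    (M * size t < size s)%N -> (forall x, x \in s -> exists2 y, y \in t & r x y) ->
  exists2 y, y \in t & (M < count (fun x => r x y) s)%N.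
Proof.
move=> lt rs; apply/hasP; apply: contraLR lt; rewrite -all_predC => /allP le.
rewrite -leqNgt; apply: (@leq_trans (\sum_(y <- t) count (fun x => r x y) s)).
  under eq_bigr => y _ do rewrite -sum1_count big_mkcond.
  rewrite exchange_big /= -sum1_size [X in (X <= _)%N]big_seq [X in (_ <= X)%N]big_seq.
  apply: leq_sum => x /rs[y yt rxy].
  by rewrite (big_rem y) //= rxy leq_addr.
rewrite -sum1_size big_distrr /= [X in (X <= _)%N]big_seq [X in (_ <= X)%N]big_seq.
by apply: leq_sum => y /le /=; rewrite -leqNgt muln1.
Qed.

Section EliminationStep.
Variables (n Q : nat) (fs : seq (tower n.+1)) (f : tower n.+1).
Hypotheses (Q_ge2 : (2 <= Q)%N) (fs_size : (size fs <= Q)%N).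
Hypothesis fs_norm : forall g, g \in fs -> (tnorm g <= 2 ^ Q)%N.
Hypotheses (f_fs : f \in fs) (f_neq0 : f != 0).

Let q := (Q ^ (2 * n + 2))%N.
Let nn := tnorm_is_norm n.
Let nn1 := tnorm_is_norm n.+1.
Let phi := kron Q.+1 n.
Let F := phi f.

Definition kron_mix (tau : nat) : {poly tower n} :=
  \sum_(j < size fs) phi fs`_j *+ tau ^ j.

(* The added multiple of [F] does not change the common zeros with [F], but
   makes the leading coefficient constant, so that the resultant with [F]
   commutes with specialization. *)
Definition kron_elim (tau : nat) : {poly tower n} :=
  kron_mix tau + F * 'X^(q.+1).

(* There are more values [tau] than [size fs] times the number of roots of [F],
   so that one root of [F] serves more than [size fs] values, and hence kills
   every [phi g] with [g \in fs]. *)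
Definition eliminants : seq (tower n) :=
  [seq resultant F (kron_elim tau) | tau <- iota 0 (q * Q).+1].

Lemma leQq : (Q <= q)%N.
Proof using All. by rewrite /q -{1}[Q]expn1 leq_pexp2l ?addnS // (leq_trans _ Q_ge2). Qed.

Lemma q_bound : (Q * (Q.+1 ^ n).+1 <= q)%N.
Proof using All.
have leS : (Q.+1 ^ n <= Q ^ (2 * n))%N.
  rewrite expnM; case: n => // k; rewrite leq_exp2r // -mulnn.
  by case: Q Q_ge2 => [|[|k']] // _; lia.
have pos : (0 < Q ^ (2 * n))%N by rewrite expn_gt0 (leq_trans _ Q_ge2).
rewrite /q addn2 expnS leq_mul // expnS.
apply: (@leq_trans (2 * Q ^ (2 * n))); last by rewrite leq_mul.
by rewrite mul2n -addnn -addn1 leq_add.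
Qed.

Lemma tnorm_phi g : g \in fs -> (@tnorm n.+1 (phi g) <= 2 ^ q)%N.
Proof using All.
move=> gfs; apply: leq_trans (tnorm_kron _ _) _ => //.
apply: (@leq_trans ((2 ^ Q) ^ (Q.+1 ^ n).+1)); first by rewrite leq_exp2r ?fs_norm.
by rewrite -expnM leq_exp2l // q_bound.
Qed.

Lemma size_phi g : g \in fs -> (size (phi g) <= q.+1)%N.
Proof using All.
move=> gfs; have [->|g0] := eqVneq (phi g) 0; first by rewrite size_poly0.
have := leq_trans (size_poly_norm nn g0) (tnorm_phi gfs).
by rewrite leq_exp2l //; case: (size _).
Qed.

Lemma kron_elim_lead : exists l : int,
  [/\ l != 0, (`|l| <= 2 ^ q)%N, lead_coef F = l%:~R &
   forall tau, lead_coef (kron_elim tau) = l%:~R].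
Proof using All.
have [|l [l0 ll _]] := @kron_lead Q.+1 n f f_neq0.
  by rewrite (leq_ltn_trans (fs_norm f_fs)) // ltn_exp2l.
exists l; split=> // [|tau].
  rewrite -(tnorm_int n) -ll lead_coefE (leq_trans (leq_norm_coef nn _ _)) //.
  exact: tnorm_phi.
rewrite /kron_elim lead_coefDr ?lead_coef_Mmonic ?monicXn //.
have F_neq0 : F != 0 by rewrite -lead_coef_eq0 ll tower_int_eq0.
rewrite size_mulXn // (@leq_ltn_trans q.+1) //; last first.
  by rewrite -{1}[q.+1]addn0 ltn_add2l lt0n size_poly_eq0.
apply: (leq_trans (size_sum _ _ _)); apply/bigmax_leqP => j _.
rewrite -scaler_nat (leq_trans (size_scale_leq _ _)) // size_phi //.
by rewrite mem_nth.
Qed.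

Lemma size_kron_elim tau : (size (kron_elim tau) <= (2 * q).+2)%N.
Proof using All.
rewrite (leq_trans (size_polyD _ _)) // geq_max; apply/andP; split.
  apply: (leq_trans (size_sum _ _ _)); apply/bigmax_leqP => j _.
  rewrite -scaler_nat (leq_trans (size_scale_leq _ _)) //.
  rewrite (leq_trans (size_phi _)) ?mem_nth //; lia.
have [->|F0] := eqVneq F 0; first by rewrite mul0r size_poly0.
rewrite size_mulXn //; have := size_phi f_fs; rewrite -/F; lia.
Qed.

Let w := (Q + q * Q ^ 2 + 3 * q + 2)%N.

Lemma tnorm_kron_elim tau : (tau <= q * Q)%N ->
  (@tnorm n.+1 (kron_elim tau) <= 2 ^ w)%N.
Proof using All.
move=> letau; apply: leq_trans (norm_D nn1 _ _) _.
have Q_gt0 : (0 < Q)%N by apply: leq_trans Q_ge2.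
have q_gt0 : (0 < q)%N by apply: leq_trans leQq.
have le1 : (@tnorm n.+1 (kron_mix tau) <= 2 ^ (Q + q * Q ^ 2 + q))%N.
  apply: leq_trans (norm_sum nn1 _ _ _) _.
  apply: (@leq_trans (\sum_(j < size fs) 2 ^ (q * Q ^ 2 + q))).
    apply: leq_sum => j _; rewrite -mulr_natr mulrC.
    apply: leq_trans (norm_M nn1 _ _) _; rewrite expnD leq_mul ?tnorm_phi ?mem_nth //.
    rewrite -[_%:R]/((_%:Z)%:~R) (leq_trans (norm_int nn1 _)) //=.
    apply: (@leq_trans ((2 ^ (q * Q)) ^ Q)); last by rewrite -expnM -mulnA mulnn.
    apply: (@leq_trans ((2 ^ (q * Q)) ^ j)).
      case: (nat_of_ord j) => // k; rewrite leq_exp2r //.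
      exact: leq_trans (ltnW (ltn_expl _ _)).
    by rewrite leq_pexp2l ?expn_gt0 // (leq_trans (ltnW (ltn_ord j))).
  rewrite sum_nat_const card_ord -[(Q + _ + q)%N]addnA [X in (_ <= X)%N]expnD leq_mul //.
  exact: leq_trans fs_size (ltnW (ltn_expl _ _)).
have le2 : (@tnorm n.+1 (F * 'X^(q.+1))%R <= 2 ^ (2 * q).+1)%N.
  apply: leq_trans (norm_M nn1 _ _) _; rewrite mul2n -addnn -addnS expnD.
  rewrite leq_mul ?tnorm_phi // (leq_trans (norm_X nn1 _ _)) //.
  by rewrite tnormX.
apply: leq_trans (leq_add le1 le2) _.
apply: (@leq_trans (2 ^ w.-1 + 2 ^ w.-1)).
  by rewrite leq_add // leq_exp2l // /w; nia.
by rewrite addnn -mul2n -expnS prednK // /w addnS.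
Qed.

Lemma eliminants_norm h : h \in eliminants -> (tnorm h <= 2 ^ (Q ^ (4 * n + 13)))%N.
Proof using All.
case/mapP => tau; rewrite mem_iota add0n ltnS => /= letau ->.
have leqw : (q <= w)%N by rewrite /w; lia.
apply: leq_trans (norm_resultant nn (W := 2 ^ w) _ _) _.
- by apply: leq_trans (tnorm_phi f_fs) _; rewrite leq_exp2l.
- exact: tnorm_kron_elim.
set S := (_ + _)%N; have leS : (S <= 3 * q + 1)%N.
  by have := size_phi f_fs; have := size_kron_elim tau; rewrite /S -/F; lia.
have fact_le k : (k`! <= k ^ k)%N.
  elim: k => // k IHk; rewrite factS expnS leq_mul // (leq_trans IHk) //.
  by case: k {IHk} => // k; rewrite leq_exp2r.
apply: (@leq_trans (2 ^ (S * S) * 2 ^ (w * S))).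
  rewrite -expnM leq_mul // (leq_trans (fact_le S)) // expnM.
  by case: (S) => // k; rewrite leq_exp2r // ltnW // ltn_expl.
rewrite -expnD leq_exp2l // -mulnDl mulnC.
apply: (@leq_trans ((3 * q + 1) * (3 * q + 1 + w))).
  by rewrite leq_mul // leq_add2r.
have := leQq; rewrite /w => leq1.
have -> : (Q ^ (4 * n + 13) = q * q * (Q ^ 2 * Q ^ 7))%N.
  by rewrite /q -!expnD; congr (_ ^ _)%N; lia.
have Q2 : (4 <= Q ^ 2)%N by rewrite -[4%N]/(2 ^ 2)%N leq_exp2r.
apply: (@leq_trans ((q * Q ^ 2) * (q * Q ^ 7))); last by rewrite mulnACA.
apply: leq_mul; first nia.
have Q7 : (Q ^ 2 * 32 <= Q ^ 7)%N.
  by rewrite (@expnD Q 2 5) leq_mul // -[32%N]/(2 ^ 5)%N leq_exp2r.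
nia.
Qed.

Lemma eliminants_size : (size eliminants <= Q ^ (4 * n + 13))%N.
Proof using All.
rewrite size_map size_iota.
have -> : (Q ^ (4 * n + 13) = q * (q * Q ^ 9))%N.
  by rewrite /q -!expnD; congr (_ ^ _)%N; lia.
have : (Q.+1 <= q * Q ^ 9)%N.
  have : (2 * Q <= q * Q ^ 9)%N.
    rewrite leq_mul ?(leq_trans _ leQq) // -{1}(expn1 Q) leq_pexp2l //.
    exact: leq_trans Q_ge2.
  lia.
have : (0 < q)%N by apply: leq_trans leQq; apply: leq_trans Q_ge2.
nia.
Qed.

End EliminationStep.

(** * Zeros of integer polynomials over varying fields *)

Lemma natr_pchar0_inj (K : idomainType) :
  [pchar K] =i pred0 -> injective (fun i : nat => i%:R : K).
Proof.
move=> /pcharf0P K0 i j; wlog leij : i j / (i <= j)%N.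
  by move=> IH eij; case/orP: (leq_total i j) => /IH; [apply | move=> <-].
move=> eij; have : (j - i)%:R == 0 :> K by rewrite natrB // eij subrr.
by rewrite K0 subn_eq0 => leji; apply/eqP; rewrite eqn_leq leij.
Qed.

Lemma intr_neq0_absz (K : nzRingType) (z : int) :
  ((`|z|%N%:R : K) != 0) = ((z%:~R : K) != 0).
Proof. by case: z => z //=; rewrite NegzE rmorphN /= oppr_eq0. Qed.

Section Elimination.
Variables (n Q : nat) (fs : seq (tower n.+1)) (f : tower n.+1).
Hypotheses (Q_ge2 : (2 <= Q)%N) (fs_size : (size fs <= Q)%N).
Hypothesis fs_norm : forall g, g \in fs -> (tnorm g <= 2 ^ Q)%N.
Hypotheses (f_fs : f \in fs) (f_neq0 : f != 0).

Let q := (Q ^ (2 * n + 2))%N.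
Let F := kron Q.+1 n f.

Lemma horner_kron_elim (K : fieldType) (u : seq K) (y : K) (tau : nat) :
  root (map_poly (teval n u) F) y ->
  (map_poly (teval n u) (kron_elim Q fs f tau)).[y] =
  (\poly_(j < size fs) teval n.+1 (kron_point Q.+1 n u y) fs`_j).[tau%:R].
Proof.
move=> /eqP yF; rewrite rmorphD rmorphM /= hornerD hornerM yF mul0r addr0.
rewrite horner_poly raddf_sum /= horner_sum; apply: eq_bigr => j _.
rewrite raddfMn /= hornerMn -natrX mulr_natr; congr (_ *+ _).
exact/esym/kron_teval.
Qed.

Lemma zeros_eliminants (K : fieldType) (l : int) (v : seq K) :
    lead_coef F = l%:~R ->
    (forall tau, lead_coef (kron_elim Q fs f tau) = l%:~R) ->
    (l%:~R : K) != 0 -> zeros fs v ->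
  zeros (eliminants Q fs f) (kron_inv Q.+1 n v).1 /\
  root (map_poly (teval n (kron_inv Q.+1 n v).1) F) (kron_inv Q.+1 n v).2.
Proof.
move=> lF lG l0 /andP[/eqP sv /allP fsv].
case: (kron_inv Q.+1 n v) (size_kron_inv Q.+1 n v) (kron_invK Q.+1 sv) => u y /= su ev.
have yF : root (map_poly (teval n u) F) y.
  by apply/eqP; rewrite -kron_teval ev (eqP (fsv _ f_fs)).
split=> //; rewrite /zeros su eqxx; apply/allP => h /mapP[tau _ ->].
apply/eqP/(@resultant_common_root _ _ _ _ _ _ _ y) => //.
- by rewrite lF rmorph_int.
- by rewrite lG rmorph_int.
apply/eqP; rewrite horner_kron_elim // horner_poly big1 // => j _.
by rewrite ev (eqP (fsv _ _)) ?mul0r // mem_nth.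
Qed.

Lemma eliminants_zeros (C : closedFieldType) (u : seq C) :
    [pchar C] =i pred0 -> zeros (eliminants Q fs f) u ->
  exists y, zeros fs (kron_point Q.+1 n u y).
Proof.
move=> C0 /andP[/eqP su /allP hsu].
have [l [l0 _ lF lG]] := kron_elim_lead Q_ge2 fs_size fs_norm f_fs f_neq0.
have l0C : (l%:~R : C) != 0.
  by have /pcharf0P CP := C0; rewrite -intr_neq0_absz CP absz_eq0.
have [r rF] := closed_field_poly_normal (map_poly (teval n u) F).
have evF : teval n u (lead_coef F) != 0 by rewrite lF rmorph_int.
have Fu0 : lead_coef (map_poly (teval n u) F) != 0.
  by rewrite lead_coef_map_id0 ?rmorph0.
have rootF y : (y \in r) = root (map_poly (teval n u) F) y.
  by rewrite rF rootZ // root_prod_XsubC.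
have sr : (size r <= q)%N.
  have : size (map_poly (teval n u) F) = (size r).+1.
    by rewrite {1}rF size_scale // size_prod_XsubC.
  rewrite size_map_poly_id0 // => e; rewrite -ltnS -e.
  exact: (size_phi Q_ge2 fs_size fs_norm f_fs f_neq0).
pose rel tau y := root (map_poly (teval n u) (kron_elim Q fs f tau)) y.
have [||y] := @pigeonhole_seq _ _ rel (iota 0 (q * Q).+1) r Q.
- by rewrite size_iota ltnS mulnC leq_mul2r sr orbT.
- move=> tau tauI; 
  have [|||y] := @common_root_exists _ _ (teval n u) F (kron_elim Q fs f tau).
  + by [].
  + by rewrite lG rmorph_int.
  + by apply/eqP/hsu/mapP; exists tau.
  by case/andP => yF yG; exists y; rewrite ?rootF.
rewrite rootF => yF lt; exists y; rewrite /zeros size_kron_point eqxx.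
apply/allP => g gfs.
set c := (fun j : nat => teval n.+1 (kron_point Q.+1 n u y) fs`_j).
have c0 : \poly_(j < size fs) c j = 0.
  apply: contraTeq lt => c0; rewrite -leqNgt -size_filter.
  rewrite -(size_map (fun i : nat => i%:R : C)) (leq_trans _ fs_size) //.
  apply: leq_trans (size_poly _ c); apply: ltnW; apply: max_poly_roots => //.
    apply/allP => _ /mapP[tau + ->]; rewrite mem_filter => /andP[+ _].
    by rewrite /rel /root horner_kron_elim.
  by rewrite map_inj_uniq ?filter_uniq ?iota_uniq //; exact: natr_pchar0_inj.
have := congr1 (fun p : {poly C} => p`_(index g fs)) c0.
by rewrite coef0 coef_poly index_mem gfs /c nth_index // => ->.
Qed.

End Elimination.

(* The zeros are counted over [K] by projecting one variable at a time; [B]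
   collects the leading coefficients that make these projections finite. *)
Theorem reduction_zeros_bound (C : closedFieldType) (n : nat) :
  [pchar C] =i pred0 ->
  exists e : nat, forall (Q : nat) (fs : seq (tower n)),
    (2 <= Q)%N -> (size fs <= Q)%N ->
    (forall g, g \in fs -> (tnorm g <= 2 ^ Q)%N) ->
    (exists M, at_most (@zeros n C fs) M) ->
  exists B : nat, [/\ (0 < B)%N, (B <= 2 ^ (Q ^ e))%N &
    forall K : fieldType, (B%:R : K) != 0 -> at_most (@zeros n K fs) (Q ^ e)].
Proof.
move=> C0; elim: n => [|n [e IHn]].
  exists 0%N => Q fs Q2 sfs nfs _; exists 1%N; split=> // K _ s us /allP zs.
  apply: (@uniq_leq_size _ s [:: [::]] us) => v /zs/andP[/eqP/size0nil -> _].
  by rewrite inE.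
pose a := (4 * n + 13)%N; exists (a * e.+1)%N => Q fs Q2 sfs nfs [M finM].
have [/hasP[f ffs f0]|/hasPn fs0] := boolP (has (fun g => g != 0) fs); last first.
  pose s := [seq nseq n.+1 (i%:R : C) | i <- iota 0 M.+1].
  have us : uniq s.
    rewrite map_inj_uniq ?iota_uniq // => i j [+ _]; exact: natr_pchar0_inj.
  have zs : all (zeros fs) s.
    apply/allP => _ /mapP[i _ ->]; rewrite /zeros size_nseq eqxx.
    by apply/allP => g /fs0 /negPn/eqP ->; rewrite rmorph0.
  by have := finM s us zs; rewrite size_map size_iota ltnn.
have [l [l0 lq lF lG]] := kron_elim_lead Q2 sfs nfs ffs f0.
have Q_gt0 : (0 < Q)%N by apply: leq_trans Q2.
have Qa : (2 <= Q ^ a)%N.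
  by rewrite (leq_trans Q2) // /a addnS expnS leq_pmulr // expn_gt0 Q_gt0.
have [|||B [B_gt0 leB cntB]] := IHn (Q ^ a)%N (eliminants Q fs f) Qa.
- exact: eliminants_size.
- exact: eliminants_norm.
- exists M => s us /allP zs.
  have lift u : exists y, u \in s -> zeros fs (kron_point Q.+1 n u y).
    case: (boolP (u \in s)) => [/zs zu|_]; last by exists 0.
    by have [y zy] := eliminants_zeros Q2 sfs nfs ffs f0 C0 zu; exists y.
  pose g u := kron_point Q.+1 n u (projT1 (cid (lift u))).
  rewrite -(size_map g); apply: finM; last first.
    by apply/allP => _ /mapP[u us' ->]; apply: (projT2 (cid (lift u))).
  rewrite map_inj_in_uniq // => u1 u2 u1s u2s /(congr1 (kron_inv Q.+1 n)).
  have [/andP[/eqP s1 _] /andP[/eqP s2 _]] := (zs _ u1s, zs _ u2s).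
  by rewrite !kron_pointK // => -[].
exists (`|l| * B)%N; split.
- by rewrite muln_gt0 absz_gt0 l0.
- apply: leq_trans (leq_mul lq leB) _; rewrite -expnD leq_exp2l //.
  rewrite -expnM mulnS [X in (_ <= X)%N]expnD.
  set X := (Q ^ (a * e))%N; have X_gt0 : (0 < X)%N by rewrite expn_gt0 Q_gt0.
  have : ((Q ^ (2 * n + 2)).+1 <= Q ^ a)%N.
    by rewrite ltn_exp2l // /a; lia.
  move=> lea; apply: (@leq_trans ((Q ^ (2 * n + 2)).+1 * X)).
    by rewrite mulSn addnC leq_add2l leq_pmulr.
  by rewrite leq_mul2r lea orbT.
move=> K; rewrite natrM mulf_eq0 negb_or intr_neq0_absz => /andP[lK BK] s us /allP zs.
pose pr v := (kron_inv Q.+1 n v : seq K * K).1.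
have szs v : v \in s -> size v = n.+1 by move=> /zs/andP[/eqP].
apply: leq_trans (leq_fibers (f := pr) (M := Q ^ a) _) _; last first.
  rewrite mulnS expnD expnM leq_mul //; apply: cntB; rewrite ?undup_uniq //.
  apply/allP => u; rewrite mem_undup => /mapP[v /zs zv ->].
  by have [] := zeros_eliminants ffs lF lG lK zv.
move=> u; rewrite -size_filter.
have evF : teval n u (lead_coef (kron Q.+1 n f)) != 0 by rewrite lF rmorph_int.
pose ys := [seq (kron_inv Q.+1 n v).2 | v <- [seq v <- s | pr v == u]].
have -> : size [seq v <- s | pr v == u] = size ys by rewrite size_map.
have : (size ys < size (map_poly (teval n u) (kron Q.+1 n f)))%N.
  apply: max_poly_roots.
  - by rewrite -lead_coef_eq0 lead_coef_map_id0 // rmorph0.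
  - apply/allP => _ /mapP[v + ->]; rewrite mem_filter => /andP[/eqP <- /zs zv].
    by have [] := zeros_eliminants ffs lF lG lK zv.
  rewrite map_inj_in_uniq ?filter_uniq // => v1 v2.
  rewrite !mem_filter => /andP[/eqP e1 /szs s1] /andP[/eqP e2 /szs s2] e12.
  by rewrite -(kron_invK Q.+1 s1) -(kron_invK Q.+1 s2) -/(pr v1) -/(pr v2) e1 e2 e12.
rewrite size_map_poly_id0 // => lt; rewrite -ltnS (leq_trans lt) //.
apply: leq_trans (size_phi Q2 sfs nfs ffs f0 ffs) _; rewrite ltnS leq_exp2l // /a; lia.
Qed.

(** * Multivariate polynomials as iterated polynomials *)

Lemma leq_expWl x y k : (x <= y)%N -> (x ^ k <= y ^ k)%N.
Proof. by case: k => // k lexy; rewrite leq_exp2r. Qed.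

Section Homogenization.
Variable m : nat.
Implicit Types (F : zpoly m) (T : comNzRingType).

Definition hom_eval T (e : nat) F (a : 'I_m -> T) (b : T) : T :=
  \sum_(mon <- msupp F)
    (mcoeff mon F)%:~R * (mmap1 a mon * b ^+ (e - mdeg mon)).

Lemma rmorph_hom_eval T (T' : comNzRingType) (f : {rmorphism T -> T'}) e F a b :
  f (hom_eval e F a b) = hom_eval e F (f \o a) (f b).
Proof.
rewrite /hom_eval rmorph_sum; apply: eq_bigr => mon _.
rewrite !rmorphM rmorph_int rmorphXn rmorph_prod; congr (_ * (_ * _)).
by apply: eq_bigr => i _; rewrite rmorphXn.
Qed.

Lemma zevalE (K : fieldType) F (x : {ffun 'I_m -> K}) :
  zeval F x = \sum_(mon <- msupp F) (mcoeff mon F)%:~R * mmap1 x mon.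
Proof.
rewrite /zeval /base_change {1}[F]mpolyE (raddf_sum (map_mpoly intr)).
rewrite (raddf_sum (meval x)); apply: eq_bigr => mon _ /=.
by rewrite map_mpolyZ mevalZ map_mpolyX mevalX.
Qed.

Lemma mdeg_leq_zdeg F mon : mon \in msupp F -> (mdeg mon <= zdeg F)%N.
Proof. by move=> /msize_mdeg_lt; rewrite /zdeg; case: (mmeasure _ _). Qed.

Lemma hom_eval_zeval (K : fieldType) (e : nat) F (a : 'I_m -> K) (b : K) :
    b != 0 -> (zdeg F <= e)%N ->
  hom_eval e F a b = b ^+ e * zeval F [ffun i => a i / b].
Proof.
move=> b0 leFe; rewrite zevalE mulr_sumr; apply: eq_big_seq => mon monF.
have leme := leq_trans (mdeg_leq_zdeg monF) leFe.
rewrite [RHS]mulrCA; congr (_ * _).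
rewrite [X in _ = _ * X](_ : _ = mmap1 a mon / b ^+ mdeg mon); last first.
  rewrite /mmap1 mdegE -prodrXr -prodf_div; apply: eq_bigr => i _.
  by rewrite ffunE expr_div_n.
rewrite mulrCA -{2}(subnK leme) exprD mulfK //.
by rewrite expf_neq0.
Qed.

Definition coef_norm F : nat := (\sum_(mon <- msupp F) `|mcoeff mon F|)%N.

Lemma tnorm_hom_eval n (e : nat) F (a : 'I_m -> tower n) (b : tower n) (W : nat) :
    (0 < W)%N -> (zdeg F <= e)%N -> (forall i, (tnorm (a i) <= W)%N) ->
    (tnorm b <= W)%N ->
  (tnorm (hom_eval e F a b) <= coef_norm F * W ^ e)%N.
Proof.
move=> W_gt0 leFe leaW lebW; have nn := tnorm_is_norm n.
apply: leq_trans (norm_sum nn _ _ _) _; rewrite /coef_norm big_distrl /=.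
rewrite [X in (X <= _)%N]big_seq [X in (_ <= X)%N]big_seq; apply: leq_sum => mon monF.
have leme := leq_trans (mdeg_leq_zdeg monF) leFe.
apply: leq_trans (norm_M nn _ _) _; apply: leq_mul; first exact: norm_int.
apply: leq_trans (norm_M nn _ _) _; rewrite -(subnKC leme) expnD addKn.
apply: leq_mul; last by apply: leq_trans (norm_X nn _ _) _; apply: leq_expWl.
apply: leq_trans (norm_prod nn _ _ _) _; rewrite mdegE expn_sum.
apply: leq_prod => i _; apply: leq_trans (norm_X nn _ _) _.
exact: leq_expWl.
Qed.

Lemma coef_norm_bound (R : realType) (e Hn : nat) (h : R) F :
    expR h <= Hn%:R -> (zdeg F <= e)%N -> zheight R F <= h ->
  (coef_norm F <= #|{: bmultinom m e.+1}| * Hn)%N.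
Proof.
move=> leh leFe hF.
have le mon : mon \in msupp F -> (`|mcoeff mon F| <= Hn)%N.
  move=> monF; rewrite /zheight in hF.
  set M := (\max_(a <- _) _)%N in hF.
  have leM : (`|mcoeff mon F| <= M)%N by rewrite /M (leq_bigmax_seq _ monF).
  have M_gt0 : (0 < M)%N.
    by apply: leq_trans leM; rewrite absz_gt0 -mcoeff_msupp.
  apply: (leq_trans leM); rewrite -(ler_nat R); apply: le_trans leh.
  by rewrite -[leLHS]lnK ?ler_expR // posrE ltr0n.
apply: (@leq_trans (\sum_(mon <- msupp F) Hn)).
  by rewrite /coef_norm [X in (X <= _)%N]big_seq [X in (_ <= X)%N]big_seq leq_sum.
rewrite big_const_seq count_predT iter_addn_0 mulnC leq_mul2r; apply/orP; right.
rewrite cardE -(size_map (@bmnm m e.+1)); apply: uniq_leq_size; first exact: msupp_uniq.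
move=> mon monF; have lt : (mdeg mon < e.+1)%N.
  by rewrite ltnS (leq_trans (mdeg_leq_zdeg monF)).
by apply/mapP; exists (BMultinom lt); rewrite ?mem_enum.
Qed.

End Homogenization.

Section TowerIso.
Variable m : nat.

Definition to_tower (F : zpoly m) : tower m :=
  mmap (intmul 1) (fun i : 'I_m => tvar m i) F.

Definition zvar (i : 'I_m) : zpoly m := mpolyX int (mnm1 i).

Definition of_tower : {rmorphism tower m -> zpoly m} :=
  teval m [seq zvar i | i <- enum 'I_m].

HB.instance Definition _ := GRing.RMorphism.copy to_tower
  (mmap (intmul 1) (fun i : 'I_m => tvar m i)).

Lemma nth_enum_map (T : Type) (x0 : T) (g : 'I_m -> T) (i : 'I_m) :
  nth x0 [seq g j | j <- enum 'I_m] i = g i.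
Proof. by rewrite (nth_map i) ?size_enum_ord // nth_ord_enum. Qed.

Lemma of_tower_var (i : 'I_m) : of_tower (tvar m i) = zvar i.
Proof. by rewrite teval_var // nth_enum_map. Qed.

Lemma to_towerX (i : 'I_m) : to_tower (zvar i) = tvar m i.
Proof. by rewrite /to_tower mmapX mmap1U. Qed.

Lemma of_towerK : cancel of_tower to_tower.
Proof.
move=> f; pose c := [seq tvar m (nat_of_ord i) | i <- enum 'I_m].
rewrite -[LHS]/((to_tower \o of_tower) f).
rewrite (@teval_unique _ m (to_tower \o of_tower : {rmorphism _ -> _}) c) => [|i lt].
  symmetry; rewrite -[LHS]/(idfun f).
  apply: (@teval_unique _ m (idfun : {rmorphism _ -> _}) c) => i lt.
  by rewrite (nth_enum_map _ _ (Ordinal lt)).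
rewrite (nth_enum_map _ _ (Ordinal lt)).
by rewrite -[LHS]/(to_tower (of_tower _)) (of_tower_var (Ordinal lt)) to_towerX.
Qed.

Lemma rmorph_to_tower (T : comNzRingType) (g : {rmorphism tower m -> T}) F :
  g (to_tower F) = \sum_(mon <- msupp F)
     (mcoeff mon F)%:~R * mmap1 (fun i : 'I_m => g (tvar m i)) mon.
Proof.
rewrite rmorph_sum; apply: eq_bigr => mon _.
rewrite rmorphM rmorph_int rmorph_prod; congr (_ * _).
by apply: eq_bigr => i _; rewrite rmorphXn.
Qed.

Lemma to_towerK : cancel to_tower of_tower.
Proof.
move=> F; rewrite rmorph_to_tower [RHS]mpolyE; apply: eq_bigr => mon _.
rewrite -mul_mpolyC (mmap1_eq _ (f2 := zvar)); last exact: of_tower_var.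
by rewrite mmap1_id -[(_)%:~R](rmorph_int (@mpolyC m int)) intz.
Qed.

Definition point_seq (K : Type) (x : {ffun 'I_m -> K}) : seq K :=
  [seq x i | i <- enum 'I_m].

Lemma teval_to_tower (K : fieldType) (x : {ffun 'I_m -> K}) F :
  teval m (point_seq x) (to_tower F) = zeval F x.
Proof.
rewrite rmorph_to_tower zevalE; apply: eq_bigr => mon _; congr (_ * _).
by apply: mmap1_eq => i; rewrite teval_var // nth_enum_map.
Qed.

Lemma has_gcds_tower n : has_gcds (tower n).
Proof. by elim: n => [|n IHn]; [exact: has_gcds_int | exact: has_gcds_poly]. Qed.

Lemma coprime_zpoly_divides (F G : zpoly m) (A B : tower m) :
    coprime_zpoly F G -> G != 0 -> A * to_tower G = to_tower F * B ->
  divides (to_tower G) B.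
Proof.
move=> coFG G_neq0 e.
have tG : to_tower G != 0.
  by apply: contraNneq G_neq0 => t0; rewrite -[G]to_towerK t0 rmorph0.
have [g [G' [F' [eG eF GF]]]] := has_gcds_tower (to_tower F) tG.
have gU : g \is a GRing.unit.
  have : of_tower g \is a GRing.unit.
    apply: (coFG _ (of_tower F') (of_tower G')).
    - by rewrite -rmorphM -eF to_towerK.
    - by rewrite -rmorphM -eG to_towerK.
  by move/(rmorph_unit to_tower) => /=; rewrite of_towerK.
have g0 : g != 0 by apply: contraTneq gU => ->; rewrite unitr0.
have [x ->] : divides G' B.
  apply: GF; exists A; apply: (mulfI g0).
  by rewrite !mulrA -eF -eG -e mulrC.
by exists (g^-1 * x); rewrite eG mulrACA divrr // mul1r.
Qed.

End TowerIso.

(** * Iterates without cancellation *)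

Section OrbitPolynomials.
Variables (m d : nat) (Rs : ratsys m).
Hypothesis Rs_deg : forall i, (rdeg (Rs i) <= d)%N.

(* Numerators and a common denominator of R^(k), without cancellation: the
   denominator vanishes at w as soon as the orbit of w stops before time k. *)
Fixpoint orbit_frac (k : nat) : ('I_m -> tower m) * tower m :=
  if k is k'.+1 then
    let: (a, b) := orbit_frac k' in
    (fun i => b * \prod_j
       hom_eval d (if j == i then rnum (Rs i) else rden (Rs j)) a b,
     b * \prod_j hom_eval d (rden (Rs j)) a b)
  else (fun i : 'I_m => tvar m i, 1).

Definition orbit_num k := (orbit_frac k).1.
Definition orbit_den k := (orbit_frac k).2.

Lemma orbit_numS k i : orbit_num k.+1 i = orbit_den k * \prod_j
  hom_eval d (if j == i then rnum (Rs i) else rden (Rs j))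
    (orbit_num k) (orbit_den k).
Proof. by rewrite /orbit_num /orbit_den /=; case: (orbit_frac k). Qed.

Lemma orbit_denS k : orbit_den k.+1 = orbit_den k * \prod_j
  hom_eval d (rden (Rs j)) (orbit_num k) (orbit_den k).
Proof. by rewrite /orbit_num /orbit_den /=; case: (orbit_frac k). Qed.

Lemma zdeg_num i : (zdeg (rnum (Rs i)) <= d)%N.
Proof. by apply: leq_trans (Rs_deg i); rewrite leq_maxl. Qed.

Lemma zdeg_den i : (zdeg (rden (Rs i)) <= d)%N.
Proof. by apply: leq_trans (Rs_deg i); rewrite leq_maxr. Qed.

Definition orbit_value (K : fieldType) (w : {ffun 'I_m -> K}) (k : nat) :
    {ffun 'I_m -> K} :=
  [ffun i => teval m (point_seq w) (orbit_num k i) /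
             teval m (point_seq w) (orbit_den k)].

Lemma orbit_pointE (K : fieldType) (w : {ffun 'I_m -> K}) k :
  orbit_point Rs w k =
  if teval m (point_seq w) (orbit_den k) != 0 then Some (orbit_value w k)
  else None.
Proof.
elim: k => [|k IHk].
  rewrite /orbit_den /= rmorph1 oner_neq0; congr Some; apply/ffunP => i.
  by rewrite ffunE rmorph1 divr1 teval_var // nth_enum_map.
rewrite /orbit_point iterS -/(orbit_point Rs w k) IHk orbit_denS rmorphM rmorph_prod.
have [b0|b0] /= := eqVneq (teval m (point_seq w) (orbit_den k)) 0.
  by rewrite b0 mul0r eqxx.
set x := orbit_value w k; set b := teval _ _ _ in b0 *.
have homx F : (zdeg F <= d)%N ->
    teval m (point_seq w) (hom_eval d F (orbit_num k) (orbit_den k)) =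
    b ^+ d * zeval F x.
  by move=> leF; rewrite rmorph_hom_eval hom_eval_zeval.
have bd0 : b ^+ d != 0 by rewrite expf_neq0.
rewrite /sys_eval mulf_eq0 negb_or b0 /=.
have -> : (\prod_j teval m (point_seq w)
     (hom_eval d (rden (Rs j)) (orbit_num k) (orbit_den k)) != 0) =
   [forall i, zeval (rden (Rs i)) x != 0].
  apply/prodf_neq0/forallP => h i; last first.
    by move=> _; rewrite homx ?zdeg_den // mulf_neq0.
  by have := h i isT; rewrite homx ?zdeg_den // mulf_eq0 negb_or => /andP[].
case: forallP => // den0; congr Some; apply/ffunP => i; rewrite !ffunE.
rewrite orbit_numS orbit_denS !rmorphM !rmorph_prod -/b (bigD1 i) //=.
rewrite [X in _ / (_ * X)](bigD1 i) //= eqxx !homx ?zdeg_num ?zdeg_den //.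
under eq_bigr => j /negPf -> do rewrite homx ?zdeg_den //.
under [X in _ / (_ * (_ * X))]eq_bigr => j _ do rewrite homx ?zdeg_den //.
set c := \prod_(j | _) _; have c0 : c != 0.
  by apply/prodf_neq0 => j _; rewrite mulf_neq0.
have := den0 i => zi0; field.
by rewrite b0 c0 zi0 bd0.
Qed.

Lemma tnorm_orbit (c0 : nat) k :
    (forall i, (coef_norm (rnum (Rs i)) <= 2 ^ c0)%N) ->
    (forall i, (coef_norm (rden (Rs i)) <= 2 ^ c0)%N) ->
  (forall i, (tnorm (orbit_num k i) <= 2 ^ ((m * (c0 + d)).+1 ^ k))%N) /\
  (tnorm (orbit_den k) <= 2 ^ ((m * (c0 + d)).+1 ^ k))%N.
Proof.
move=> numc denc; have nn := tnorm_is_norm m.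
set Z := (m * (c0 + d)).+1; elim: k => [|k [IHn IHd]].
  by split=> [i|]; rewrite expn0 ?tnorm_var // norm_1.
have step (F : 'I_m -> zpoly m) :
    (forall j, (zdeg (F j) <= d)%N /\ (coef_norm (F j) <= 2 ^ c0)%N) ->
  (tnorm (orbit_den k * \prod_j hom_eval d (F j) (orbit_num k) (orbit_den k))%R
     <= 2 ^ (Z ^ k.+1))%N.
  move=> FP; apply: leq_trans (norm_M nn _ _) _.
  rewrite expnS {1}/Z mulSn expnD leq_mul //.
  apply: leq_trans (norm_prod nn _ _ _) _.
  have -> : (2 ^ (m * (c0 + d) * Z ^ k) =
      \prod_(j < m) 2 ^ ((c0 + d) * Z ^ k))%N.
    by rewrite prod_nat_const card_ord -expnM -mulnA mulnC.
  apply: leq_prod => j _; have [degj normj] := FP j.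
  apply: leq_trans (tnorm_hom_eval (W := 2 ^ (Z ^ k)) _ degj IHn IHd) _.
    by rewrite expn_gt0.
  rewrite mulnDl expnD -expnM [(d * _)%N]mulnC leq_mul //.
  by rewrite (leq_trans normj) // leq_exp2l // leq_pmulr // expn_gt0.
split=> [i|]; first rewrite orbit_numS; last rewrite orbit_denS.
  by apply: step => j; case: eqP => _; split; rewrite ?zdeg_num ?zdeg_den.
by apply: step => j; split; rewrite ?zdeg_den.
Qed.

Definition generic_point : {ffun 'I_m -> ratfun m} :=
  [ffun i => FracField.tofrac (zvar i)].

Lemma teval_generic f :
  teval m (point_seq generic_point) f = FracField.tofrac (of_tower m f) :> ratfun m.
Proof.
symmetry; rewrite -[LHS]/((@FracField.tofrac (zpoly m) \o of_tower m) f).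
apply: (@teval_unique _ m
  (@FracField.tofrac (zpoly m) \o of_tower m : {rmorphism tower m -> ratfun m})) => i lt.
rewrite (nth_enum_map _ _ (Ordinal lt)) ffunE.
by rewrite -[LHS]/(FracField.tofrac (of_tower m _)) (of_tower_var (Ordinal lt)).
Qed.

Lemma iter_eval_orbit (K : fieldType) (w x : {ffun 'I_m -> K}) k :
    sys_iter Rs k <> None -> orbit_point Rs w k = Some x ->
  iter_eval Rs k w = Some x.
Proof.
rewrite /iter_eval; case defRn: (sys_iter Rs k) => [Rn|] // _.
move: defRn; rewrite /sys_iter -/generic_point orbit_pointE.
case: ifP => // denX [eRn]; rewrite orbit_pointE; case: ifP => // denw [<-] /=.
have lowest_eq i : orbit_num k i * to_tower (rden (Rn i)) =
    to_tower (rnum (Rn i)) * orbit_den k.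
  have [G0 _ eq_i] := lowestP (Rn i).
  rewrite -[LHS]of_towerK -[RHS]of_towerK; congr to_tower.
  rewrite !rmorphM !to_towerK; apply/eqP; rewrite -tofrac_eq !tofracM.
  rewrite -eqr_div ?tofrac_eq0 //; last first.
    by rewrite teval_generic tofrac_eq0 in denX.
  by rewrite -!teval_generic -eq_i -eRn ffunE.
have eval_eq i : zeval (rden (Rn i)) w != 0.
  have [G0 coFG _] := lowestP (Rn i).
  have [e eB] := coprime_zpoly_divides coFG G0 (lowest_eq i).
  apply: contraNneq denw => Gw0.
  by rewrite eB rmorphM teval_to_tower Gw0 mul0r.
rewrite /sys_eval; case: forallP => [_|[]//]; congr Some; apply/ffunP => i.
rewrite !ffunE; apply/eqP; rewrite eqr_div //.
by rewrite -!teval_to_tower -!rmorphM -lowest_eq mulrC.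
Qed.

End OrbitPolynomials.

Section ReturnSystem.
Variables (m d D s : nat) (Rs : ratsys m) (P : 'I_s -> zpoly m).
Hypothesis Rs_deg : forall i, (rdeg (Rs i) <= d)%N.
Hypothesis P_deg : forall j, (zdeg (P j) <= D)%N.

Definition return_poly (j : 'I_s) (k : nat) : tower m :=
  hom_eval D (P j) (orbit_num d Rs k) (orbit_den d Rs k).

Lemma teval_return_poly (K : fieldType) (w : {ffun 'I_m -> K}) j k :
    teval m (point_seq w) (orbit_den d Rs k) != 0 ->
  (teval m (point_seq w) (return_poly j k) == 0) =
  (zeval (P j) (orbit_value d Rs w k) == 0).
Proof.
move=> den0; rewrite /return_poly rmorph_hom_eval hom_eval_zeval //.
by rewrite mulf_eq0 expf_eq0 (negPf den0) andbF.
Qed.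

(* The extra, outermost variable is the inverse of the denominator of R^(k). *)
Definition return_system (k : nat) : seq (tower m.+1) :=
  ('X * (orbit_den d Rs k)%:P - 1) ::
  [seq (return_poly j 0)%:P | j <- enum 'I_s] ++
  [seq (return_poly j k)%:P | j <- enum 'I_s].

Lemma zeros_return_system (K : fieldType) (w : {ffun 'I_m -> K}) y k :
  @zeros m.+1 K (return_system k) (y :: point_seq w) =
  [&& y * teval m (point_seq w) (orbit_den d Rs k) == 1, in_variety P w
    & in_variety P (orbit_value d Rs w k)].
Proof.
have [ev evE] : exists ev, ev = teval m.+1 (y :: point_seq w) by eexists.
rewrite /zeros -evE /= size_map size_enum_ord eqxx /=.
rewrite [X in (X == 0) && _](_ : _ =
    y * teval m (point_seq w) (orbit_den d Rs k) - 1); last first.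
  by rewrite evE tevalS rmorphB rmorphM rmorph1 /= map_polyX map_polyC !hornerE.
rewrite subr_eq0; case: eqP => //= yden.
have den0 : teval m (point_seq w) (orbit_den d Rs k) != 0.
  by apply: contra_eqN yden => /eqP ->; rewrite mulr0 eq_sym oner_eq0.
have all_eq k' : teval m (point_seq w) (orbit_den d Rs k') != 0 ->
    all (fun f => ev f == 0)
      [seq (return_poly j k')%:P | j <- enum 'I_s] =
    in_variety P (orbit_value d Rs w k').
  move=> den'0; rewrite all_map /in_variety; apply/allP/forallP => h j.
    have := h j (mem_enum _ _); rewrite /= -(teval_return_poly _ den'0).
    rewrite evE tevalS map_polyC hornerC.
    by [].
  move=> _; have := h j; rewrite /= -(teval_return_poly _ den'0).
    rewrite evE tevalS map_polyC hornerC.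
  by [].
rewrite all_cat !all_eq //; last by rewrite rmorph1 oner_neq0.
congr (in_variety P _ && _); apply/ffunP => i; rewrite ffunE rmorph1 divr1.
by rewrite teval_var // nth_enum_map.
Qed.

Lemma return_system_finite (R : realType) k :
    (0 < k)%N -> generically_escapes R Rs P ->
  exists M, at_most (@zeros m.+1 R[i] (return_system k)) M.
Proof.
move=> k_gt0 /(_ k k_gt0)[defk /finite_seqP[pts ptsE]].
exists (size pts) => t ut /allP zt.
pose wof (v : seq R[i]) : {ffun 'I_m -> R[i]} := [ffun i => nth 0 (behead v) (nat_of_ord i)].
have ptK v : size v = m.+1 -> v = head 0 v :: point_seq (wof v).
  case: v => //= y u [su]; congr (_ :: _).
  apply: (@eq_from_nth _ 0); first by rewrite size_map size_enum_ord.
  by rewrite su => i lt; rewrite (nth_enum_map _ _ (Ordinal lt)) ffunE.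
have szt v : v \in t -> size v = m.+1 by move=> /zt/andP[/eqP].
rewrite -(size_map wof); apply: uniq_leq_size.
  rewrite map_inj_in_uniq // => v1 v2 v1t v2t e12.
  have := zt _ v1t; have := zt _ v2t.
  rewrite (ptK _ (szt _ v1t)) (ptK _ (szt _ v2t)) !zeros_return_system e12.
  move=> /andP[/eqP y2 _] /andP[/eqP y1 _]; congr (_ :: _).
  have den0 : teval m (point_seq (wof v2)) (orbit_den d Rs k) != 0.
    by apply: contra_eqN y1 => /eqP ->; rewrite mulr0 eq_sym oner_eq0.
  by apply: (mulIf den0); rewrite y1 y2.
move=> _ /mapP[v vt ->]; have := zt _ vt.
rewrite (ptK _ (szt _ vt)) zeros_return_system /= => /and3P[/eqP yden Vw Vx].
have den0 : teval m (point_seq (wof v)) (orbit_den d Rs k) != 0.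
  by apply: contra_eqN yden => /eqP ->; rewrite mulr0 eq_sym oner_eq0.
suff : [set` pts]%classic (wof v) by rewrite -(ptK _ (szt _ vt)).
rewrite -ptsE; split=> //; exists (orbit_value d Rs (wof v) k) => //.
by apply: (iter_eval_orbit Rs_deg) => //; rewrite (orbit_pointE Rs_deg) den0.
Qed.

End ReturnSystem.

(** * Return times *)

Section OrbitLength.
Variables (K : fieldType) (m : nat) (Rs : ratsys m) (w : {ffun 'I_m -> K}).

Lemma orbit_pointD n k :
  orbit_point Rs w (n + k) =
  obind (fun x => orbit_point Rs x k) (orbit_point Rs w n).
Proof.
rewrite /orbit_point addnC iterD; case: (iter n _ _) => //=.
by elim: k => //= k ->.
Qed.

Lemma orbit_set_leq (R : realType) N (t : seq {ffun 'I_m -> K}) :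
    (N%:R%:E <= orbit_length R Rs w)%E ->
    (forall n x, (0 < n)%N -> orbit_point Rs w n = Some x -> x \in t) ->
  (N <= size t)%N.
Proof.
move=> leN sub; have subt : (orbit_set Rs w `<=` [set` t])%classic.
  by move=> x [n n_gt0 /(sub n x n_gt0)].
have fin : finite_set (orbit_set Rs w) by apply: sub_finite_set subt _.
move: leN; rewrite /orbit_length; case: pselect => // fin'.
rewrite lee_fin ler_nat => /leq_trans; apply.
apply: uniq_leq_size; first exact: fset_uniq.
by move=> x; rewrite in_fset_set // => /set_mem/subt.
Qed.

Lemma orbit_long (R : realType) N :
    (N%:R%:E <= orbit_length R Rs w)%E ->
  (forall n, (n <= N)%N -> orbit_point Rs w n != None) /\
  (forall i j, (i < j < N)%N -> orbit_point Rs w i != orbit_point Rs w j).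
Proof.
move=> leN.
have def n : (n <= N)%N -> orbit_point Rs w n != None.
  case: n => // n lt; apply/negP => /eqP none.
  pose t := pmap (orbit_point Rs w) (iota 1 n).
  have : (N <= size t)%N.
    apply: (orbit_set_leq leN) => k x k_gt0 ex.
    rewrite mem_pmap; apply/mapP; exists k => //; rewrite mem_iota k_gt0 add1n.
    rewrite ltnNge; apply/negP => le; move: ex.
    by rewrite -(subnKC le) orbit_pointD none.
  rewrite size_pmap leqNgt (leq_ltn_trans (count_size _ _)) //.
  by rewrite size_iota.
have neq i j : (0 < i)%N -> (i < j <= N)%N -> orbit_point Rs w i != orbit_point Rs w j.
  move=> i_gt0 /andP[ltij lejN]; apply/negP => /eqP eij.
  pose t := pmap (orbit_point Rs w) (iota 1 j.-1).
  have : (N <= size t)%N.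
    apply: (orbit_set_leq leN) => k; have [n] := ubnP k; elim: n k => // n IHn k.
    rewrite ltnS => lekn x k_gt0 ex; have [ltkj|lejk] := ltnP k j.
      rewrite mem_pmap; apply/mapP; exists k => //.
      by rewrite mem_iota k_gt0 add1n prednK // (leq_trans _ ltij).
    apply: (IHn (i + (k - j))%N); first lia.
      by rewrite addn_gt0 i_gt0.
    by rewrite orbit_pointD eij -orbit_pointD subnKC.
  rewrite size_pmap leqNgt (leq_ltn_trans (count_size _ _)) //.
  by rewrite size_iota; lia.
split=> // -[|i] j /andP[ltij ltjN]; last by apply: neq => //; rewrite ltij ltnW.
apply/negP => /eqP e0j; have := neq 1%N j.+1 isT; rewrite !ltnS ltij ltjN => /(_ isT).
by rewrite -[1%N]add0n -[j.+1]addn1 !orbit_pointD e0j eqxx.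
Qed.

End OrbitLength.

Lemma return_times_bound N L T (A : {set 'I_N}) :
    (0 < L)%N ->
    (forall k, (0 < k < L)%N ->
       (#|[set n in A | [exists n' in A, n' == n + k :> nat]]| <= T)%N) ->
  (#|A| <= (N %/ L).+1 + L * T)%N.
Proof.
move=> L_gt0 leT; pose S k := [set n in A | [exists n' in A, (n' == n + k :> nat)%N]].
pose U := \bigcup_(k < L | (0 < k)%N) S k.
have leU : (#|U| <= L * T)%N.
  apply: (@leq_trans (\sum_(k < L | (0 < k)%N) #|S k|)).
    rewrite /U; elim/big_rec2: _ => [|k a B _ le]; first by rewrite cards0.
    by apply: leq_trans (leq_card_setU _ _) _; rewrite leq_add2l.
  apply: (@leq_trans (\sum_(k < L | (0 < k)%N) T)).
    by apply: leq_sum => k k_gt0; apply: leT; rewrite k_gt0 ltn_ord.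
  by rewrite sum_nat_const leq_mul2r (leq_trans (max_card _)) ?card_ord ?orbT.
rewrite -(cardsID U A) addnC leq_add //; last first.
  by rewrite (leq_trans _ leU) // subset_leq_card // subsetIr.
pose quo (n : 'I_N) : 'I_(N %/ L).+1 := inord (n %/ L).
rewrite -[X in (_ <= X)%N]card_ord -(@card_in_imset _ _ quo).
  exact: max_card.
have block (i j : 'I_N) : i \in A :\: U -> j \in A -> (i %/ L = j %/ L)%N -> ~ (i < j)%N.
  rewrite inE => /andP[/negP iU iA] jA eij ltij; apply: iU.
  have ltL : (j - i < L)%N.
    have := divn_eq i L; have := divn_eq j L; have := ltn_pmod j L_gt0; rewrite eij; lia.
  apply/bigcupP; exists (Ordinal ltL) => /=; first by rewrite subn_gt0.
  rewrite inE iA; apply/existsP; exists j; rewrite jA /= subnKC //; exact: ltnW.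
move=> i j iU jU /(congr1 val) /=; rewrite !inordK ?ltnS ?leq_div2r //; try exact: ltnW.
move=> eij; have [iA jA] : i \in A /\ j \in A.
  by move: iU jU; rewrite !inE => /andP[_ ->] /andP[_ ->].
apply: val_inj; case: (ltngtP i j) => // [lt|lt].
  by case: (block _ _ iU jA eij).
by case: (block _ _ jU iA (esym eij)).
Qed.

Section VisitsBound.
Variables (R : realType) (m d D s c0 c1 : nat) (Rs : ratsys m) (P : 'I_s -> zpoly m).
Hypothesis Rs_deg : forall i, (rdeg (Rs i) <= d)%N.
Hypothesis P_deg : forall j, (zdeg (P j) <= D)%N.
Hypothesis num_norm : forall i, (coef_norm (rnum (Rs i)) <= 2 ^ c0)%N.
Hypothesis den_norm : forall i, (coef_norm (rden (Rs i)) <= 2 ^ c0)%N.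
Hypothesis P_norm : forall j, (coef_norm (P j) <= 2 ^ c1)%N.

Let Z := (m * (c0 + d)).+1.
Let C := (Z + c1 + D + 2 * s + 4)%N.

Lemma return_system_norm k L g : (k < L)%N -> g \in return_system d D Rs P k ->
  (@tnorm m.+1 g <= 2 ^ (C ^ L))%N.
Proof using P_deg P_norm Rs_deg den_norm num_norm.
move=> ltkL; have nn := tnorm_is_norm m; have nn1 := tnorm_is_norm m.+1.
have C_gt0 : (0 < C)%N by rewrite /C addnS.
have orbk k' := tnorm_orbit Rs_deg k' num_norm den_norm.
have leZ k' : (k' < L)%N -> (Z ^ k' * C <= C ^ L)%N.
  move=> lt; rewrite -(subnK lt) addnS expnS mulnC leq_mul // expnD.
  rewrite (leq_trans (leq_expWl (y := C) k' _)) ?leq_pmull ?expn_gt0 ?C_gt0 //.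
  by rewrite /C; lia.
have Zk_gt0 k' : (0 < Z ^ k')%N by rewrite expn_gt0.
have norm_ret j k' : (k' < L)%N ->
    (@tnorm m.+1 (return_poly d D Rs P j k')%:P <= 2 ^ (C ^ L))%N.
  move=> lt; have [numk denk] := orbk k'.
  rewrite tnormC (leq_trans (tnorm_hom_eval _ (P_deg j) numk denk)) ?expn_gt0 //.
  apply: (@leq_trans (2 ^ c1 * 2 ^ (Z ^ k' * D))); first by rewrite leq_mul // -expnM.
  rewrite -expnD leq_exp2l // (leq_trans _ (leZ _ lt)) //.
  have := Zk_gt0 k'; rewrite /C; nia.
rewrite inE mem_cat => /orP[/eqP ->|/orP[]/mapP[j _ ->]]; last 2 first.
- by apply: norm_ret; apply: leq_ltn_trans ltkL.
- exact: norm_ret.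
have [_ denk] := orbk k.
apply: leq_trans (norm_D nn1 _ _) _; rewrite (norm_N nn1) (norm_1 nn1).
apply: (@leq_trans (2 * 2 ^ (Z ^ k) + 2 * 2 ^ (Z ^ k))).
  apply: leq_add; last by rewrite muln_gt0 expn_gt0.
  apply: leq_trans (norm_M nn1 _ _) _; rewrite tnormX tnormC.
  by rewrite leq_mul2l.
rewrite addnn -mul2n -!expnS leq_exp2l // (leq_trans _ (leZ _ ltkL)) //.
have := Zk_gt0 k; rewrite /C; nia.
Qed.

Lemma visits_pair (K : fieldType) (w : {ffun 'I_m -> K}) N (n : 'I_N) :
  orbit_point Rs w n != None -> n \in visits Rs P w N ->
  exists2 x, orbit_point Rs w n = Some x & in_variety P x.
Proof using Rs_deg.
case e: (orbit_point Rs w n) => [x|] // _; rewrite inE.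
case ev: (iter_eval Rs n w) => [v|] // vP; exists x => //.
have defn : sys_iter Rs n <> None by move=> e0; move: ev; rewrite /iter_eval e0.
by have := iter_eval_orbit Rs_deg defn e; rewrite ev => -[<-].
Qed.

Lemma visits_return (K : fieldType) (w : {ffun 'I_m -> K}) N k T :
    (N%:R%:E <= orbit_length R Rs w)%E ->
    at_most (@zeros m.+1 K (return_system d D Rs P k)) T ->
  (#|[set n in visits Rs P w N |
     [exists n' in visits Rs P w N, n' == n + k :> nat]]| <= T)%N.
Proof using P_deg Rs_deg.
move=> /orbit_long[def neq] leT; set S := finset _.
pose x (n : 'I_N) := odflt w (orbit_point Rs w n).
have xE (n : 'I_N) : orbit_point Rs w n = Some (x n).
  by rewrite /x; case: (orbit_point Rs w n) (def n (ltnW (ltn_ord n))).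
pose v n := (teval m (point_seq (x n)) (orbit_den d Rs k))^-1 :: point_seq (x n).
rewrite cardE -(size_map v); apply: leT.
  rewrite map_inj_uniq ?enum_uniq // => i j [_ eij].
  have {}eij : x i = x j.
    apply/ffunP => l; rewrite -(nth_enum_map 0 (x i)) -(nth_enum_map 0 (x j)).
    by rewrite -/(point_seq _) eij.
  apply: val_inj; case: (ltngtP i j) => // lt.
    by have := neq i j; rewrite lt ltn_ord !xE eij eqxx => /(_ isT).
  by have := neq j i; rewrite lt ltn_ord !xE eij eqxx => /(_ isT).
apply/allP => _ /mapP[n + ->]; rewrite mem_enum inE.
case/andP => nV /existsP[n' /andP[n'V /eqP en']].
have [y ey yV] : exists2 y, orbit_point Rs w n = Some y & in_variety P y.
  by apply: visits_pair nV; apply: def; apply: ltnW.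
have [y' ey' y'V] : exists2 y, orbit_point Rs w n' = Some y & in_variety P y.
  by apply: visits_pair n'V; apply: def; apply: ltnW.
rewrite xE in ey; case: ey => ey; rewrite -ey in yV.
move: ey'; rewrite en' orbit_pointD xE /= (orbit_pointE Rs_deg).
case: ifP => // den0 [ey']; rewrite /v zeros_return_system //.
by rewrite mulVf ?den0 // eqxx yV ey'.
Qed.

End VisitsBound.

Theorem visits_bound (R : realType) (m d D s c0 c1 : nat) :
  exists2 C : nat, (4 <= C)%N &
    forall (Rs : ratsys m) (P : 'I_s -> zpoly m),
      (forall i, [/\ (rdeg (Rs i) <= d)%N, (coef_norm (rnum (Rs i)) <= 2 ^ c0)%N
         & (coef_norm (rden (Rs i)) <= 2 ^ c0)%N]) ->
      (forall j, (zdeg (P j) <= D)%N /\ (coef_norm (P j) <= 2 ^ c1)%N) ->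
      generically_escapes R Rs P ->
      forall L : nat, (0 < L)%N ->
      exists B : nat, [/\ (0 < B)%N, (B <= 2 ^ (C ^ L))%N &
        forall (K : fieldType) (w : {ffun 'I_m -> K}) (N : nat),
          (B%:R : K) != 0 -> (C ^ L <= N)%N ->
          (N%:R%:E <= orbit_length R Rs w)%E ->
          (#|visits Rs P w N| * L <= 2 * N)%N].
Proof.
have C0 : [pchar R[i]] =i pred0 by exact: Num.Theory.pchar_num.
have [e eP] := @reduction_zeros_bound R[i] m.+1 C0.
pose C1 := ((m * (c0 + d)).+1 + c1 + D + 2 * s + 4)%N.
have C1_gt0 : (0 < C1)%N by rewrite /C1 addnS.
exists (4 * C1 ^ e)%N; first by rewrite leq_pmulr // expn_gt0 C1_gt0.
move=> Rs P RsP PP esc L L_gt0; pose Q := (C1 ^ L)%N.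
have CL : ((4 * C1 ^ e) ^ L = 4 ^ L * Q ^ e)%N.
  by rewrite expnMn -!expnM [(e * L)%N]mulnC.
have Qe_gt0 : (0 < Q ^ e)%N by rewrite !expn_gt0 C1_gt0.
have Rs_deg i := let: And3 h _ _ := RsP i in h.
have num_norm i := let: And3 _ h _ := RsP i in h.
have den_norm i := let: And3 _ _ h := RsP i in h.
have P_deg j := let: conj h _ := PP j in h.
have P_norm j := let: conj _ h := PP j in h.
have leC1Q : (C1 <= Q)%N by rewrite /Q -{1}(expn1 C1) leq_pexp2l.
have Bk k : exists B : nat, (0 < k < L)%N -> [/\ (0 < B)%N, (B <= 2 ^ (Q ^ e))%N &
    forall K : fieldType, (B%:R : K) != 0 ->
      at_most (@zeros m.+1 K (return_system d D Rs P k)) (Q ^ e)].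
  case: (boolP (0 < k < L)%N) => [/andP[k_gt0 ltkL]|_]; last by exists 0%N.
  have [||||B HB] := eP Q (return_system d D Rs P k); last by exists B.
  - by apply: leq_trans leC1Q; rewrite /C1 !addnS.
  - rewrite /= size_cat 2!size_map size_enum_ord (leq_trans _ leC1Q) // /C1; lia.
  - by move=> g; apply: return_system_norm.
  - exact: return_system_finite.
pose B k := projT1 (cid (Bk k)).
have BP k := projT2 (cid (Bk k)); rewrite -/(B _) in BP.
exists (\prod_(k < L | (0 < k)%N) B k)%N; split.
- by rewrite prodn_cond_gt0 // => k k_gt0; have [|] := BP k; rewrite ?k_gt0 ?ltn_ord.
- apply: (@leq_trans (\prod_(k < L | (0 < k)%N) 2 ^ (Q ^ e))).
    by apply: leq_prod => k k_gt0; have [|] := BP k; rewrite ?k_gt0 ?ltn_ord.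
  rewrite prod_nat_const -expnM leq_exp2l // CL mulnC leq_mul2r.
  apply/orP; right; apply: leq_trans (max_card _) _; rewrite card_ord.
  exact: ltnW (ltn_expl _ _).
move=> K w N BK leN long.
have leT : (#|visits Rs P w N| <= (N %/ L).+1 + L * Q ^ e)%N.
  apply: return_times_bound => // k /andP[k_gt0 ltkL].
  apply: (visits_return Rs_deg P_deg long); have [|_ _] := BP k.
    by rewrite k_gt0.
  apply; apply: contraNneq BK => Bk0.
  by rewrite natr_prod (bigD1 (Ordinal ltkL)) //= Bk0 mul0r.
have leL : (L + L * L * Q ^ e <= N)%N.
  apply: leq_trans leN; rewrite CL.
  apply: (@leq_trans ((L + L * L) * Q ^ e)).
    by rewrite mulnDl leq_add2r leq_pmulr.
  rewrite leq_mul2r -mulnS -[4%N]/(2 * 2)%N expnMn; apply/orP; right.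
  by apply: leq_mul; [apply: ltnW|]; exact: ltn_expl.
have := leq_trunc_div N L; move: leT leL; set X := (Q ^ e)%N; set q := (N %/ L)%N.
move=> leT leL leq; apply: leq_trans (leq_mul leT (leqnn L)) _.
by rewrite mulnDl mulSn [(L * X * L)%N]mulnAC; lia.
Qed.

Lemma Fp_natr_neq0 (p B : nat) (K : closedFieldType) (iota : {rmorphism 'F_p -> K}) :
  prime p -> ~~ (p %| B)%N -> (B%:R : K) != 0.
Proof.
move=> p_pr; apply: contra; rewrite -(rmorph_nat iota) fmorph_eq0.
by rewrite (dvdn_pcharf (pchar_Fp p_pr)).
Qed.

Lemma expR_natX (R : realType) (C L : nat) : (0 < C)%N ->
  (C ^ L)%N%:R = expR (L%:R * ln C%:R) :> R.
Proof.
by move=> C_gt0; rewrite mulrC expRM_natr lnK ?natrX // posrE ltr0n.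
Qed.

Theorem theorem5p3 (R : realType) (m d D s : nat) (h H : R) :
  (2 <= m)%N -> (2 <= d)%N ->
  exists2 c : R, 0 < c &
    forall (Rs : ratsys m) (P : 'I_s -> zpoly m),
      (forall i, (rdeg (Rs i) <= d)%N /\ rheight R (Rs i) <= h) ->
      (forall j, (zdeg (P j) <= D)%N /\ zheight R (P j) <= H) ->
      generically_escapes R Rs P ->
      forall (eps : R) (N : nat), 0 < eps -> expR (c / eps) <= N%:R ->
        exists B : nat,
          [/\ (0 < B)%N, ln (B%:R : R) <= expR (c / eps) &
            forall (p : nat) (K : closedFieldType)
                (iota : {rmorphism 'F_p -> K}) (w : {ffun 'I_m -> K}),
              prime p -> ~~ (p %| B)%N -> integralRange iota ->
              (N%:R%:E <= orbit_length R Rs w)%E ->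
              #|visits Rs P w N|%:R / N%:R <= eps].
Proof.
move=> _ _.
pose bound (x : R) := (Num.truncn (expR x)).+1.
have boundP x : expR x <= (bound x)%:R by apply/ltW/truncnS_gt.
pose c0 := (#|{: bmultinom m d.+1}| * bound h)%N.
pose c1 := (#|{: bmultinom m D.+1}| * bound H)%N.
have [C C_ge4 CP] := visits_bound R m d D s c0 c1.
have C_gt0 : (0 < C)%N by apply: leq_trans C_ge4.
have lnC_gt0 : 0 < ln (C%:R : R) by rewrite ln_gt0 // ltr1n (leq_trans _ C_ge4).
exists (3 * ln C%:R); first by rewrite mulr_gt0.
move=> Rs P RsP PP esc eps N eps_gt0 leN.
have N_gt0 : (0 < N)%N by rewrite -(ltr0n R) (lt_le_trans (expR_gt0 _) leN).
have [eps_ge1|eps_lt1] := leP 1 eps.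
  exists 1%N; split=> //; first by rewrite ln1 expR_ge0.
  move=> p K iota w _ _ _ _; rewrite ler_pdivrMr ?ltr0n //.
  apply: (@le_trans _ _ N%:R); last by rewrite ler_peMl.
  by rewrite ler_nat -[X in (_ <= X)%N]card_ord max_card.
pose L := (Num.truncn (2 / eps)).+1.
have L_gt : 2 / eps < L%:R by exact: truncnS_gt.
have L_le : L%:R <= 3 / eps.
  have inv_ge1 : 1 <= eps^-1 by rewrite invf_ge1 // ltW.
  have : (Num.truncn (2 / eps))%:R <= 2 / eps by rewrite truncn_le divr_ge0 // ltW.
  rewrite /L -addn1 natrD; lra.
have CL_le : (C ^ L)%N%:R <= expR (3 * ln C%:R / eps) :> R.
  rewrite expR_natX // ler_expR mulrAC ler_wpM2r //; exact: ltW.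
have le_exp2 k : (k <= 2 ^ k)%N by apply/ltnW/ltn_expl.
have [||B [B_gt0 leB BP]] := CP Rs P _ _ esc L isT.
- move=> i; have [degi hi] := RsP i; have := hi; rewrite ge_max => /andP[hn hd].
  have /andP[dn dd] : (zdeg (rnum (Rs i)) <= d)%N && (zdeg (rden (Rs i)) <= d)%N.
    by rewrite -geq_max.
  split; [exact: degi | |]; apply: leq_trans _ (le_exp2 c0);
    exact: coef_norm_bound (boundP h) _ _.
- move=> j; have [degj hj] := PP j; split=> //.
  by apply: leq_trans _ (le_exp2 c1); apply: coef_norm_bound (boundP H) _ _.
exists B; split=> //.
  apply: le_trans CL_le; rewrite -ler_expR lnK ?posrE ?ltr0n //.
  apply: (@le_trans _ _ (2 ^ (C ^ L))%N%:R); first by rewrite ler_nat.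
  rewrite natrX -[X in expR X]mulr1 expRM_natl lerXn2r ?nnegrE ?expR_ge0 //.
  by have := expR_ge1Dx (1 : R); rewrite -natr1.
move=> p K iota w p_pr pB _ long.
have := BP K w N (Fp_natr_neq0 iota p_pr pB) _ long.
rewrite -(ler_nat R) => /(_ (le_trans CL_le leN)); rewrite -(ler_nat R) !natrM => le2.
have L_gt0 : 0 < L%:R :> R by rewrite ltr0n.
rewrite ler_pdivrMr ?ltr0n // -(ler_pM2r L_gt0) (le_trans le2) //.
rewrite mulrAC ler_wpM2r //.
by move: L_gt; rewrite ltr_pdivrMr // mulrC => /ltW.
Qed.
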